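(* Let $N,M\ge1$ be integers and fix $q\in\mathbb R$. Suppose that for each $p\le q$ the following hold: the control $\boldsymbol\theta(t)=\boldsymbol\theta(t;p,\mathbf x)\in\mathbb R^M$ is admissible, i.e. piecewise continuous on $t\in[p,q]$; the dynamics function $\mathbf f\colon[p,q]\times\mathbb R^N\times\mathbb R^M\to\mathbb R^N$, $(t,\mathbf z,\boldsymbol\theta)\mapsto\mathbf f(t,\mathbf z,\boldsymbol\theta)$, is continuous on $(t,\boldsymbol\theta)\in[p,q]\times\mathbb R^M$ and continuously differentiable on $\mathbf z\in\mathbb R^N$; and for $t\in[p,q]$ the state $\mathbf z(t)=\mathbf z(t;p,\mathbf x)\in\mathbb R^N$ and the control $\boldsymbol\theta(t;p,\mathbf x)$ satisfy $$\dot{\mathbf z}(t)=\mathbf f(t,\mathbf z(t),\boldsymbol\theta(t)),\qquad\mathbf z(p)=\mathbf x,$$ for each $\mathbf x\in\mathbb R^N$. Suppose the terminal loss $\mathcal T$ is a loss function on $\mathbb R^N$, the running loss $\mathcal R$ is a square-integrable functional on $[p,q]\times\mathbb R^N\times\mathbb R^M$, and the total loss is $$\mathcal J(\boldsymbol\theta;p,\mathbf x)=\int_p^q\mathcal R\big(t,\mathbf z(t;p,\mathbf x),\boldsymbol\theta(t;p,\mathbf x)\big)\,dt+\mathcal T\big(\mathbf z(q;p,\mathbf x)\big).$$ Let $\boldsymbol\lambda(t;p,\mathbf x)\in\mathbb R^N$ be the associated Lagrange multiplier (adjoint state), and put $\boldsymbol\Lambda(p,\mathbf x):=\boldsymbol\lambda(p;p,\mathbf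 x)$ and $\boldsymbol\Psi(p,\mathbf x):=\boldsymbol\theta(p;p,\mathbf x)$. Then the first-order optimality condition for the total loss $\mathcal J(\boldsymbol\theta;p,\mathbf x)$ to be minimised is given by $$[\nabla_{\boldsymbol\theta}\mathcal R]\big(p,\mathbf x,\boldsymbol\Psi(p,\mathbf x)\big)+[\nabla_{\boldsymbol\theta}\mathbf f]\big(p,\mathbf x,\boldsymbol\Psi(p,\mathbf x)\big)^{\mathrm T}\cdot\boldsymbol\Lambda(p,\mathbf x)=0.$$
   Context: The notation $\mathbf z(t;p,\mathbf x)$, $\boldsymbol\theta(t;p,\mathbf x)$ makes explicit the dependence on the input location $p$ and the input value $\mathbf x$. The terminal loss $\mathcal T$ measures the discrepancy between the system output $\mathbf z(q)$ and a known target output $\mathbf y\in\mathbb R^N$; the running loss $\mathcal R$ regulates the state and the control over $[p,q]$. The problem is to minimise $\mathcal J$ over piecewise continuous controls, with the state determined by the control through the differential equation. ''First-order optimality condition'' is meant in the sense of the calculus of variations: a first-order necessary condition for $\boldsymbol\theta$ to be a minimiser. The Lagrange multiplier (adjoint state) $\boldsymbol\lambda(t;p,\mathbf x)$ encodes the backward-propagated losses: for $t\in[p,q]$, $$\dot{\boldsymbol\lambda}(t;p,\mathbf x)=-\big([\nabla_{\mathbf z}\mathbf f](t,\mathbf z,\boldsymbol\theta)^{\mathrm T}\cdot\boldsymbol\lambda(t;p,\mathbf x)+[\nabla_{\mathbf z}\mathcal R](t,\mathbf z,\boldsymbol\theta)\big),\qquad\boldsymbol\lambda(q;p,\mathbf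 x)=[\nabla_{\mathbf z}\mathcal T](\mathbf z(q;p,\mathbf x)),$$ with $\mathbf z=\mathbf z(t;p,\mathbf x)$ and $\boldsymbol\theta=\boldsymbol\theta(t;p,\mathbf x)$. Here the dot denotes the derivative in $t$; for a vector field $\mathbf F(\mathbf v)$, $\nabla_{\mathbf v}\mathbf F=(\partial F_i/\partial v_j)_{i,j}$ is the Jacobian matrix; gradients of scalar functions are read as column vectors where they are added to vectors. Brackets such as $[\nabla_{\boldsymbol\theta}\mathbf f](\cdots)$ mean that the differential operator acts before evaluation. $\mathrm T$ denotes transposition and $\cdot$ matrix multiplication.
   Formalization: The condition is proved for p<q only (at p=q every control is a minimiser and it fails); the running loss is also assumed as regular as f (continuous, continuously differentiable in z) and differentiable in θ, as square-integrability alone does not suffice; controls are continuous at p and q. *)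

(* Defs.v *)
(* MathComp-Analysis. *)
From HB Require Import structures.
From mathcomp Require Import all_boot all_order all_algebra.
From mathcomp Require Import all_classical all_reals all_analysis.

Set Implicit Arguments.
Unset Strict Implicit.
Unset Printing Implicit Defensive.

Import Order.TTheory GRing.Theory Num.Theory.
Import numFieldNormedType.Exports.

Local Open Scope classical_set_scope.
Local Open Scope ring_scope.

Section differential_operators.
Context {R : realType}.

(* (dF_i / dv_j)_{i,j}, on column vectors; the library's ['J] acts on row
   vectors and is the transpose of this matrix. *)
Definition Jac n m (F : 'cV[R]_m -> 'cV[R]_n) (v : 'cV[R]_m) : 'M[R]_(n, m) :=
  \matrix_(i < n, j < m) 'D_(delta_mx j 0) (fun w => F w i 0) v.

Definition grad m (g : 'cV[R]_m -> R) (v : 'cV[R]_m) : 'cV[R]_m :=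
  \col_(j < m) 'D_(delta_mx j 0) g v.

End differential_operators.

Section regularity.
Context {R : realType} (N M : nat) (p q : R).

(* Continuous in (t, theta) for every z, and continuously differentiable in z,
   the z-derivative being jointly continuous on [p, q] x R^N x R^M. Joint
   continuity of F itself follows. *)
Definition C1_in_state (W : normedModType R)
    (F : R -> 'cV[R]_N -> 'cV[R]_M -> W) : Prop :=
  [/\ forall z : 'cV[R]_N,
        {within [set s : R * 'cV[R]_M | s.1 \in `[p, q]],
          continuous (fun s => F s.1 z s.2)},
      forall t z v, t \in `[p, q] -> differentiable (fun w => F t w v) z
    & forall e : 'cV[R]_N,
        {within [set s : R * 'cV[R]_N * 'cV[R]_M | s.1.1 \in `[p, q]],
          continuous (fun s => 'D_e (fun w => F s.1.1 w s.2) s.1.2)}].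

Definition differentiable_in_control (W : normedModType R)
    (F : R -> 'cV[R]_N -> 'cV[R]_M -> W) : Prop :=
  forall t z v, t \in `[p, q] -> differentiable (F t z) v.

End regularity.

(* Iterated Lebesgue integral over R^n of a nonnegative function, one coordinate
   at a time; by Tonelli it is the integral against n-dimensional Lebesgue
   measure whenever g is measurable. *)
Fixpoint integral_cV {R : realType} (n : nat) :
    ('cV[R]_n -> \bar R) -> \bar R :=
  match n with
  | 0 => fun g => g 0
  | k.+1 => fun g =>
      (\int[lebesgue_measure]_(s in setT)
         integral_cV (fun v : 'cV[R]_k => g (col_mx (s%:M : 'cV[R]_1) v)))%E
  end.

(* Finite L^2 norm on [p, q] x R^N x R^M. Measurability is not restated: this is
   only applied to functions that are continuous on that set. *)
Definition square_integrable {R : realType} (N M : nat) (p q : R)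
    (L : R -> 'cV[R]_N -> 'cV[R]_M -> R) : Prop :=
  (\int[lebesgue_measure]_(t in `[p, q])
     integral_cV (fun z => integral_cV (fun v => ((L t z v) ^+ 2)%:E)) < +oo)%E.

Section control_problem.
Context {R : realType} (N M : nat).
Implicit Types (p q : R) (x : 'cV[R]_N).
Implicit Types (u : R -> 'cV[R]_M) (z : R -> 'cV[R]_N).

(* Finitely many discontinuities, all of them interior and with finite one-sided
   limits. Continuity at the endpoints is part of the convention: otherwise the
   value u p, a single point, would be irrelevant to the dynamics and losses. *)
Definition piecewise_continuous p q u : Prop :=
  exists2 s : seq R, {subset s <= `]p, q[} &
    forall t, t \in `[p, q] ->
      if t \in s then cvg (u @ t^'-) /\ cvg (u @ t^'+)
      else u @ within [set` `[p, q]] (nbhs t) --> u t.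

(* z is continuous on [p, q] and z' = g(t, z, u) holds at the interior points
   where u is continuous: at the finitely many other points z need not be
   differentiable. *)
Definition ode_along p q u (g : R -> 'cV[R]_N -> 'cV[R]_M -> 'cV[R]_N) z : Prop :=
  {within `[p, q], continuous z} /\
  forall t, t \in `]p, q[ -> {for t, continuous u} ->
    is_derive t (1 : R) z (g t (z t) (u t)).

Definition state p q (f : R -> 'cV[R]_N -> 'cV[R]_M -> 'cV[R]_N) x u z : Prop :=
  ode_along p q u f z /\ z p = x.

Definition adjoint_state p q (f : R -> 'cV[R]_N -> 'cV[R]_M -> 'cV[R]_N)
    (L : R -> 'cV[R]_N -> 'cV[R]_M -> R) (T : 'cV[R]_N -> R) u z
    (lam : R -> 'cV[R]_N) : Prop :=
  ode_along p q u
    (fun t l v => - ((Jac (fun w => f t w v) (z t))^T *m l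
                     + grad (fun w => L t w v) (z t))) lam
  /\ lam q = grad T (z q).

Definition total_loss p q (L : R -> 'cV[R]_N -> 'cV[R]_M -> R)
    (T : 'cV[R]_N -> R) u z : R :=
  \int[lebesgue_measure]_(t in `[p, q]) L t (z t) (u t) + T (z q).

(* The pair (u, z) minimises the total loss among all admissible controls, each
   taken with the state it determines on [p, q] from x. *)
Definition minimises p q (f : R -> 'cV[R]_N -> 'cV[R]_M -> 'cV[R]_N)
    (L : R -> 'cV[R]_N -> 'cV[R]_M -> R) (T : 'cV[R]_N -> R) x u z : Prop :=
  forall u' z', piecewise_continuous p q u' -> state p q f x u' z' ->
    total_loss p q L T u z <= total_loss p q L T u' z'.

End control_problem.

(* Main.v *)
Require Import Defs.
From HB Require Import structures.
From mathcomp Require Import all_boot all_order all_algebra.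
From mathcomp Require Import all_classical all_reals all_analysis.
From mathcomp Require Import ring lra.

Set Implicit Arguments.
Unset Strict Implicit.
Unset Printing Implicit Defensive.

Import Order.TTheory GRing.Theory Num.Theory.
Import numFieldNormedType.Exports.

Local Open Scope classical_set_scope.
Local Open Scope ring_scope.

(* Needle variation. Replacing the optimal control u by a constant w on
   [p, p + h[ yields, by Picard iteration started at z, a state y with
   |y - z| = O(h). Put H(t, y, v) = lambda(t) . f(t, y, v) + R(t, y, v) and
     phi(t) = lambda(t) . (y(t) - z(t)) + \int_p^t (R(s, y, u') - R(s, z, u)) ds,
   u' being the modified control. By the adjoint equation,
     phi' = H(t, y, u') - H(t, z, u) - D_z H(t, z, u)(y - z),
   which is within o(1) of H(p, x, w) - H(p, x, u(p)) on [p, p + h] and is o(h)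
   afterwards; the terminal condition on lambda makes phi(q) the variation of
   the loss up to o(h). Minimality thus forces H(p, x, w) >= H(p, x, u(p)) for
   every w, and the gradient of H(p, x, .) at u(p) is the left-hand side. *)

(** The data are continuous in the control and differentiable in it at each point, but nothing
    bounds how that derivative varies, so differentiating the loss along [u + s * v] under the
    integral is not justified. A needle is a change of control that is large but brief: losses are
    then compared through regularity in the state, and differentiability in the control enters only
    at [(p, x)], where it turns a minimum over all control values into a vanishing gradient. The
    needle starts at [p] because the condition is wanted there; continuity of [u] at [p] ties the
    single value [u p] to the loss.

    The other obstacle is that [f] has no global Lipschitz bound, so a perturbed state might not
    exist up to [q]. The work is therefore done in a tube around [z], whose radius comes from
    compactness and is fixed before the error [e] and the needle length. Growth estimates compare
    derivatives off a finite set of times, since states and multiplier may have none where the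
    control jumps. *)

Lemma within_itv_cvgP {R : realType} {V : pseudoMetricNormedZmodType R}
    (a b : R) (f : R -> V) :
  {within `[a, b], continuous f} <->
  forall t, t \in `[a, b] -> forall e, 0 < e -> exists2 d, 0 < d &
    forall s, s \in `[a, b] -> `|s - t| < d -> `|f s - f t| < e.
Proof.
split=> [/subspace_continuousP fc t tab e e0|fc].
  have /cvgrPdist_lt /(_ e e0) /nbhs_ballP[d /= d0 dP] := fc t tab.
  exists d => // s sab st; rewrite distrC; apply: dP => //.
  by rewrite /ball /= distrC.
apply/subspace_continuousP => t tab; apply/cvgrPdist_lt => e e0.
have [d d0 dP] := fc t tab e e0.
apply/nbhs_ballP; exists d => //= s; rewrite /ball /= => st sab.
by rewrite distrC; apply: dP => //; rewrite distrC.
Qed.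

(** * Calculus on an interval off a finite set *)

(** Induction on the exceptional points: cutting the interval at one of them removes it from both
    halves, and continuity of [g] up to the cut lets the two inequalities be chained. *)
Lemma ler_off_finite {R : realType} (s : seq R) (g : R -> R) (a b : R) :
  a <= b -> {within `[a, b], continuous g} ->
  (forall t, t \in `]a, b[ -> t \notin s ->
    derivable g t 1 /\ 0 <= 'D_1 g t) ->
  g a <= g b.
Proof.
elim: s a b => [|c s IHs] a b ab gc dg.
  apply: (@ger0_derive1_le_cc _ g a b) => //.
  - by move=> t tab; apply: (dg t tab _).1.
  - by move=> t tab; rewrite derive1E; apply: (dg t tab _).2.
  - by rewrite bound_itvE.
  - by rewrite bound_itvE.
have [cab|cab] := boolP (c \in `]a, b[); last first.
  apply: IHs => // t tab ts; apply: dg => //; rewrite inE negb_or ts andbT.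
  by apply: contraNneq cab => <-.
have [ac cb] : a < c /\ c < b by move: cab; rewrite in_itv /= => /andP[].
apply: (@le_trans _ _ (g c)); apply: IHs; rewrite ?ltW//.
- apply: continuous_subspaceW gc; apply: subset_itvl; rewrite bnd_simp; exact: ltW.
- move=> t /[!in_itv]/= /andP[at_ tc] ts; apply: dg.
    by rewrite in_itv /= at_ (lt_trans tc).
  by rewrite inE negb_or ts andbT lt_eqF.
- apply: continuous_subspaceW gc; apply: subset_itvr; rewrite bnd_simp; exact: ltW.
- move=> t /[!in_itv]/= /andP[ct tb] ts; apply: dg.
    by rewrite in_itv /= tb (lt_trans ac).
  by rewrite inE negb_or ts andbT gt_eqF.
Qed.

(** Both [e - g] and [e + g] are nondecreasing. Growth estimates below go through this comparison
    instead of integrating derivatives. *)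
Lemma normr_le_of_derive {R : realType} (s : seq R) (g e dg de : R -> R)
    (a b : R) :
  a <= b -> {within `[a, b], continuous g} -> {within `[a, b], continuous e} ->
  (forall t, t \in `]a, b[ -> t \notin s ->
    [/\ is_derive t (1 : R) g (dg t), is_derive t (1 : R) e (de t)
      & `|dg t| <= de t]) ->
  `|g a| <= e a -> `|g b| <= e b.
Proof.
move=> ab gc ec dge.
rewrite !ler_norml => /andP[ga1 ga2].
have H1 : e a - g a <= e b - g b.
  apply: (@ler_off_finite _ s (e - g)) => //; first exact: within_continuousB.
  move=> t tab ts; have [h1 h2] := dge t tab ts.
  rewrite ler_norml => /andP[_ h3]; split; first exact: derivableB.
  by rewrite derive_val subr_ge0.
have H2 : e a + g a <= e b + g b.
  apply: (@ler_off_finite _ s (e + g)) => //; first exact: within_continuousD.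
  move=> t tab ts; have [h1 h2] := dge t tab ts.
  rewrite ler_norml => /andP[h3 _]; split; first exact: derivableD.
  by rewrite derive_val; lra.
by apply/andP; split; lra.
Qed.

Section primitive.
Context {R : realType} (p q : R) (s : seq R) (g : R -> R) (B : R).
Hypothesis g_bound : forall t, t \in `[p, q] -> `|g t| <= B.
Hypothesis g_cont : forall t, t \in `]p, q[ -> t \notin s -> {for t, continuous g}.

(** Measurability is the only issue: the interval is covered by an open set on which [g] is
    continuous and a finite set, all of whose subsets are measurable. *)
Lemma integrable_off_finite :
  (@lebesgue_measure R).-integrable `[p, q] (EFin \o g).
Proof.
apply: measurable_bounded_integrable => //=.
- rewrite lebesgue_measure_itv /=; case: ifP => //= _.
  by rewrite -EFinB ltry.
- have fin_s : finite_set [set` p :: q :: s] by exact: finite_seq.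
  have op : open (`]p, q[ `\` [set` s]).
    rewrite setDE; apply: openI; first exact: interval_open.
    apply: closed_openC; apply: accessible_finite_set_closed.1 (finite_seq s).
    exact/hausdorff_accessible/Rhausdorff.
  have ms : measurable [set` p :: q :: s].
    exact: countable_measurable (finite_set_countable fin_s).
  apply: (@measurable_funS _ _ _ _ ((`]p, q[ `\` [set` s]) `|` [set` p :: q :: s])).
  + by apply: measurableU => //; exact: measurable_realfun.open_measurable.
  + move=> t tpq; have /andP[pt tq] : p <= t <= q by have := tpq; rewrite /= in_itv.
    have [ts|ts] := boolP (t \in p :: q :: s); [by right|left].
    move: ts; rewrite !inE !negb_or => /and3P[tp tq' ts].
    split; last exact/negP.
    by rewrite /= in_itv /= !lt_neqAle eq_sym tp pt tq' tq.
  + apply/measurable_funU => //; first exact: measurable_realfun.open_measurable.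
    split; last first.
      move=> _ Y mY; apply: countable_measurable => //.
      apply: finite_set_countable; apply: sub_finite_set fin_s.
      exact: subIsetl.
    apply: measurable_realfun.open_continuous_measurable_fun => // t; rewrite inE => -[tpq ts].
    by apply: g_cont => //; exact/negP.
- exists B; split; first by rewrite num_real.
  move=> x Bx t /= tpq; exact: le_trans (g_bound tpq) (ltW Bx).
Qed.

Definition primitive (t : R) : R := \int[lebesgue_measure]_(x in `[p, t]) g x.

Lemma primitive0 : primitive p = 0.
Proof. by rewrite /primitive set_itv1 Rintegral_set1. Qed.

Lemma primitive_continuous : p <= q -> {within `[p, q], continuous primitive}.
Proof.
move=> pq; exact: parameterized_integral_continuous pq integrable_off_finite.
Qed.

Lemma is_derive_primitive t : t \in `]p, q[ -> {for t, continuous g} ->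
  is_derive t (1 : R) primitive (g t).
Proof.
rewrite in_itv /= => /andP[pt tq] gt.
have [dF FE] := continuous_FTC1_closed tq integrable_off_finite pt gt.
by apply: DeriveDef; [exact: dF|rewrite -derive1E; exact: FE].
Qed.

End primitive.

(* Used with [r] as a radius and, through [r^-1], as a bound at the same time. *)
Lemma exists_common_radius {R : realType} (I : finType) (P : I -> R -> Prop) :
  (forall i r r', 0 < r' -> r' <= r -> P i r -> P i r') ->
  (forall i, exists2 r, 0 < r & P i r) ->
  exists2 r, 0 < r & forall i, P i r.
Proof.
move=> Pmon Pex.
have /choice[r rP] (i : I) : exists r, 0 < r /\ P i r by have [r] := Pex i; exists r.
have r0 : 0 < \big[Num.min/1]_i r i.
  by apply: lt_bigmin => // i _; apply: (rP i).1.
exists (\big[Num.min/1]_i r i) => // i.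
by apply: Pmon (rP i).2 => //; exact: bigmin_le.
Qed.

(** * Joint continuity, and uniform estimates in a tube around a path *)

Definition jointly_continuous {R : realType} {V U : normedModType R} (p q : R)
    (G : R -> V -> U -> R) : Prop :=
  forall t0 y0 v0, t0 \in `[p, q] -> forall e, 0 < e -> exists2 d, 0 < d &
    forall t y v, t \in `[p, q] -> `|t - t0| < d -> `|y - y0| < d ->
      `|v - v0| < d -> `|G t y v - G t0 y0 v0| < e.

Lemma within_jointly_continuous {R : realType} {V U : normedModType R} (p q : R)
    (G : R -> V -> U -> R) :
  {within [set s : R * V * U | s.1.1 \in `[p, q]],
     continuous (fun s => G s.1.1 s.1.2 s.2)} ->
  jointly_continuous p q G.
Proof.
move=> /subspace_continuousP Gc t0 y0 v0 t0pq e e0.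
have /cvgrPdist_lt /(_ e e0) /nbhs_ballP[d /= d0 dP] := Gc (t0, y0, v0) t0pq.
exists d => // t y v tpq tt0 yy0 vv0; rewrite distrC.
apply: (dP (t, y, v)) => //; rewrite /ball /=; split; last first.
  by rewrite -ball_normE /= distrC.
by split => /=; rewrite -ball_normE /= distrC.
Qed.

Section tube.
Context {R : realType} {V : normedModType R} {M : nat} (p q : R).
Implicit Types (u : R -> 'cV[R]_M) (z : R -> V).

(** At a break [vl] and [vr] are the one-sided limits; at any other time, endpoints included, both
    are [u t0]. This gives one statement for the two cases of the definition. *)
Lemma piecewise_continuous_sided u t0 : piecewise_continuous p q u ->
  t0 \in `[p, q] ->
  exists vl vr, forall e, 0 < e -> exists2 d, 0 < d &
    forall t, t \in `[p, q] -> `|t - t0| < d ->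
      `|u t - (if t < t0 then vl else if t0 < t then vr else u t0)| < e.
Proof.
move=> [s _ sP] t0pq; have := sP t0 t0pq.
case: ifPn => _; last first.
  move=> uc; exists (u t0), (u t0) => e e0.
  have /cvgrPdist_lt /(_ e e0) /nbhs_ballP[d /= d0 dP] := uc.
  exists d => // t tpq tt0; rewrite distrC !if_same; apply: dP => //.
  by rewrite -ball_normE /= distrC.
move=> [/cvg_ex[vl cl] /cvg_ex[vr cr]]; exists vl, vr => e e0.
have /cvgrPdist_lt /(_ e e0) /nbhs_ballP[d /= d0 dP] := cl.
have /cvgrPdist_lt /(_ e e0) /nbhs_ballP[d' /= d'0 d'P] := cr.
exists (Num.min d d'); first by rewrite lt_min d0.
move=> t tpq; rewrite lt_min distrC => /andP[td td'].
case: (ltgtP t t0) => tt0 /=.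
- by rewrite distrC; apply: dP => //; rewrite -ball_normE.
- by rewrite distrC; apply: d'P => //; rewrite -ball_normE.
- by rewrite tt0 subrr normr0.
Qed.

(* A local estimate along z becomes uniform by compactness of [p, q]; the graph
   of u is not compact, but near each time u is close to one of three values. *)
Lemma uniform_along_graph (u : R -> 'cV[R]_M) z (Q : R -> R -> V -> V -> 'cV[R]_M -> Prop) :
  piecewise_continuous p q u -> {within `[p, q], continuous z} ->
  (forall r r' t y y' v, 0 < r' -> r' <= r -> Q r t y y' v -> Q r' t y y' v) ->
  (forall t0 v0, t0 \in `[p, q] -> exists2 d, 0 < d & forall t y y' v,
     t \in `[p, q] -> `|t - t0| < d -> `|y - z t0| < d -> `|y' - z t0| < d ->
     `|v - v0| < d -> Q d t y y' v) ->
  exists2 r, 0 < r &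
    forall t y, t \in `[p, q] -> `|y - z t| < r -> Q r t y (z t) (u t).
Proof.
move=> upc zc Qmon Qloc.
pose P (r : R) (t : R) := t \in `[p, q] ->
  forall y, `|y - z t| < r -> Q r t y (z t) (u t).
(* Compactness in near-covering form: what holds for times near each [t0] and all small radii holds
   for all times with a common radius. *)
have cov : near_covering [set` `[p, q]].
  by apply/compact_near_coveringP; exact: segment_compact.
have loc t0 : [set` `[p, q]] t0 ->
    filter_prod (nbhs t0) (0 : R)^'+ (fun tr => P tr.2 tr.1).
  move=> t0pq.
  have [vl [vr ulr]] := piecewise_continuous_sided upc t0pq.
  have [d1 d10 Q1] := Qloc t0 vl t0pq.
  have [d2 d20 Q2] := Qloc t0 vr t0pq.
  have [d3 d30 Q3] := Qloc t0 (u t0) t0pq.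
  pose d := Num.min (Num.min d1 d2) d3.
  have d0 : 0 < d by rewrite !lt_min d10 d20.
  have [[dd1 dd2] dd3] : (d <= d1 /\ d <= d2) /\ d <= d3.
    by rewrite /d !ge_min !lexx ?orbT.
  clearbody d.
  have d20' : 0 < d / 2 by rewrite divr_gt0.
  have [c c0 cP] := (within_itv_cvgP _ _ _).1 zc t0 t0pq _ d20'.
  have [b b0 bP] := ulr _ d0.
  pose a := Num.min (Num.min c b) d.
  have a0 : 0 < a by rewrite !lt_min c0 b0 d0.
  exists (ball t0 a, [set r | 0 < r < d / 2]).
    split; first exact: nbhsx_ballx.
    by apply: filterS2 (nbhs_right_gt (0 : R)) (nbhs_right_lt d20') => r /= -> ->.
  move=> -[t r] /= [tt0 /andP[r0 rd]] tpq y yr.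
  have {tt0} : `|t - t0| < a by rewrite distrC; rewrite -ball_normE in tt0.
  rewrite !lt_min -andbA => /and3P[tc tb td].
  have zt : `|z t - z t0| < d / 2 by exact: cP.
  have half_d : d / 2 < d by rewrite gtr_pMr // invf_lt1 // ltr1n.
  have yt : `|y - z t0| < d.
    rewrite (_ : y - z t0 = (y - z t) + (z t - z t0)); last by rewrite addrA subrK.
    apply: (le_lt_trans (ler_normD _ _)); rewrite [ltRHS]splitr ltrD //.
    exact: lt_trans yr rd.
  (* [vk] is one of the three candidate values for [u t] and [dk] its local radius; [Qmon] then
     shrinks [dk] to [r]. *)
  have concl dk vk : d <= dk -> (forall t y y' v,
      t \in `[p, q] -> `|t - t0| < dk -> `|y - z t0| < dk -> `|y' - z t0| < dk ->
      `|v - vk| < dk -> Q dk t y y' v) ->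
      `|u t - vk| < d -> Q r t y (z t) (u t).
    move=> ddk Qk ut; apply: (Qmon dk) => //.
      exact: le_trans (ltW (lt_trans rd half_d)) ddk.
    apply: Qk => //; apply: lt_le_trans ddk => //; exact: lt_trans zt half_d.
  have := bP t tpq tb; case: ifPn => _; last case: ifPn => _.
  - exact: concl Q1.
  - exact: concl Q2.
  - exact: concl Q3.
have near_r := cov _ (0 : R)^'+ P _ loc.
have [r [r0 rP]] := filter_ex (filterI (nbhs_right_gt (0 : R)) (near_r _)).
by exists r => // t y tpq; exact: rP.
Qed.

Lemma tube_bounded u z (G : R -> V -> 'cV[R]_M -> R) :
  piecewise_continuous p q u -> {within `[p, q], continuous z} ->
  jointly_continuous p q G -> exists2 r, 0 < r &
    forall t y, t \in `[p, q] -> `|y - z t| < r -> `|G t y (u t)| <= r^-1.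
Proof.
move=> upc zc Gc.
have [||r r0 rP] := @uniform_along_graph u z (fun r t y y' v => `|G t y v| <= r^-1) upc zc.
- move=> r r' t y y' v r'0 r'r /le_trans; apply.
  by rewrite lef_pV2 // posrE; lra.
- move=> t0 v0 t0pq.
  have [d d0 dP] := Gc t0 (z t0) v0 t0pq 1 ltr01.
  (* Near the base point [G] is bounded by [a^-1]; the minimum of [d] and [a] serves as radius and
     as inverse bound together. *)
  pose a := (`|G t0 (z t0) v0| + 1)^-1.
  have a0 : 0 < a by rewrite invr_gt0; have := normr_ge0 (G t0 (z t0) v0); lra.
  exists (Num.min d a); first by rewrite lt_min d0.
  move=> t y y' v tpq; rewrite !lt_min => /andP[td _] /andP[yd _] _ /andP[vd _].
  have /ltW h := dP t y v tpq td yd vd.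
  apply: (@le_trans _ _ a^-1).
    have := ler_normD (G t y v - G t0 (z t0) v0) (G t0 (z t0) v0).
    by rewrite subrK /a invrK; lra.
  by rewrite lef_pV2 ?posrE ?ge_min ?lexx ?orbT // lt_min d0.
- by exists r.
Qed.

(** Both values are compared with the one at a common base point, at cost [e / 2] each. This is why
    the predicate in [uniform_along_graph] carries two states. *)
Lemma tube_close u z (G : R -> V -> 'cV[R]_M -> R) e :
  piecewise_continuous p q u -> {within `[p, q], continuous z} ->
  jointly_continuous p q G -> 0 < e ->
  exists2 r, 0 < r & forall t y, t \in `[p, q] -> `|y - z t| < r ->
    `|G t y (u t) - G t (z t) (u t)| < e.
Proof.
move=> upc zc Gc e0.
have [||r r0 rP] :=
    @uniform_along_graph u z (fun r t y y' v => `|G t y v - G t y' v| < e) upc zc.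
- by [].
- move=> t0 v0 t0pq.
  have e20 : 0 < e / 2 by rewrite divr_gt0.
  have [d d0 dP] := Gc t0 (z t0) v0 t0pq _ e20.
  exists d => // t y y' v tpq tt0 yd y'd vd.
  have h1 := dP t y v tpq tt0 yd vd.
  have h2 := dP t y' v tpq tt0 y'd vd.
  rewrite (_ : _ - _ = (G t y v - G t0 (z t0) v0) - (G t y' v - G t0 (z t0) v0)).
    by apply: (le_lt_trans (ler_normB _ _)); lra.
  by ring.
- by exists r.
Qed.

End tube.

(** The filter form gives access to the limit laws for sums and products. *)
Lemma jointly_continuousP {R : realType} {V U : normedModType R} (p q : R)
    (G : R -> V -> U -> R) :
  jointly_continuous p q G <->
  forall s0 : R * V * U, s0.1.1 \in `[p, q] ->
    (fun s : R * V * U => G s.1.1 s.1.2 s.2) @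
      within [set s | s.1.1 \in `[p, q]] (nbhs s0) --> G s0.1.1 s0.1.2 s0.2.
Proof.
split=> [Gc [[t0 y0] v0] t0pq | Gc]; last first.
  by apply: within_jointly_continuous; apply/subspace_continuousP.
apply/cvgrPdist_lt => e e0; have [d d0 dP] := Gc t0 y0 v0 t0pq e e0.
apply/nbhs_ballP; exists d => // -[[t y] v].
rewrite /ball /= => -[[/= tt0 yy0] vv0] tpq.
rewrite -!ball_normE /= in yy0 vv0; rewrite distrC.
by apply: dP => //; rewrite distrC.
Qed.

Section jointly_continuous_lemmas.
Context {R : realType} {V U : normedModType R} (p q : R).
Implicit Types (G H : R -> V -> U -> R).

Lemma jointly_continuousD G H :
  jointly_continuous p q G -> jointly_continuous p q H ->
  jointly_continuous p q (fun t y v => G t y v + H t y v).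
Proof.
move=> /jointly_continuousP Gc /jointly_continuousP Hc.
by apply/jointly_continuousP => s spq; apply: cvgD; [exact: Gc|exact: Hc].
Qed.

Lemma jointly_continuousM G H :
  jointly_continuous p q G -> jointly_continuous p q H ->
  jointly_continuous p q (fun t y v => G t y v * H t y v).
Proof.
move=> /jointly_continuousP Gc /jointly_continuousP Hc.
by apply/jointly_continuousP => s spq; apply: cvgM; [exact: Gc|exact: Hc].
Qed.

Lemma jointly_continuous_sum n (G : 'I_n -> R -> V -> U -> R) :
  (forall i, jointly_continuous p q (G i)) ->
  jointly_continuous p q (fun t y v => \sum_i G i t y v).
Proof.
move=> Gc; apply/jointly_continuousP => s spq.
apply: cvg_big => [|i _]; first exact: add_continuous.
exact: (jointly_continuousP _ _ _).1 (Gc i) s spq.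
Qed.

Lemma jointly_continuous_time (l : R -> R) : {within `[p, q], continuous l} ->
  jointly_continuous p q (fun t (_ : V) (_ : U) => l t).
Proof.
move=> lc t0 y0 v0 t0pq e e0.
have [d d0 dP] := (within_itv_cvgP _ _ _).1 lc t0 t0pq e e0.
by exists d => // t y v tpq tt0 _ _; exact: dP.
Qed.

End jointly_continuous_lemmas.

(** * First-order estimates in the state variable *)

Section directional.
Context {R : realType} {N : nat}.
Implicit Types (h : 'cV[R]_N -> R) (y d : 'cV[R]_N).

Lemma ler_entry_norm y i : `|y i 0| <= `|y|.
Proof.
rewrite [leRHS]/Num.Def.normr /= mx_normrE.
by apply: (le_bigmax_cond _ (fun ij => `|y ij.1 ij.2|) (j := (i, 0))).
Qed.

Lemma derive_sum_entry h y d : differentiable h y ->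
  'D_d h y = \sum_j d j 0 * 'D_(delta_mx j 0) h y.
Proof.
move=> hy; rewrite deriveE // {1}(matrix_sum_delta d) raddf_sum /=.
apply: eq_bigr => j _; rewrite big_ord1 linearZ /= deriveE //.
Qed.

Lemma is_derive_along h y d (s : R) : derivable h (y + s *: d) d ->
  is_derive s (1 : R) (fun a => h (y + a *: d)) ('D_d h (y + s *: d)).
Proof.
move=> hd.
suff E : (fun a : R => a^-1 *: (((fun b => h (y + b *: d)) \o shift s) (a *: (1 : R))
                  - h (y + s *: d))) =
    (fun a : R => a^-1 *: ((h \o shift (y + s *: d)) (a *: d) - h (y + s *: d))).
  by apply: DeriveDef; rewrite /derivable /derive /= E.
apply/funext => a /=; congr (_ *: (h _ - _)).
by rewrite [a *: 1]mulr1 scalerDl addrCA.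
Qed.

(** Mean value theorem on the segment from [y'] to [y]; the factor [N%:R] comes from summing over
    coordinates in the maximum norm. With [c = 0] it is a Lipschitz bound, with [c] the partial
    derivatives at [y'] a Taylor remainder. *)
Lemma first_order_le h y y' (c : 'I_N -> R) (e : R) :
  (forall a, differentiable h a) ->
  (forall (s : R) j, 0 <= s <= 1 ->
     `|'D_(delta_mx j 0) h (y' + s *: (y - y')) - c j| <= e) ->
  `|h y - h y' - \sum_j (y - y') j 0 * c j| <= N%:R * e * `|y - y'|.
Proof.
move=> hd hc; set d := y - y'.
have dg (s : R) : is_derive s (1 : R) (fun a => h (y' + a *: d))
    ('D_d h (y' + s *: d)).
  by apply: is_derive_along; exact: diff_derivable.
have [|s] := @MVT_segment R (fun a => h (y' + a *: d))
    (fun s => 'D_d h (y' + s *: d)) 0 1 ler01.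
- by apply: derivable_within_continuous => s _; exact: (@ex_derive _ _ _ _ _ _ _ (dg s)).
rewrite in_itv /= scale1r scale0r addr0 subr0 mulr1 subrKC => s01 ->.
rewrite derive_sum_entry // -sumrB -mulrA mulr_natl.
apply: (le_trans (ler_norm_sum _ _ _)).
have -> : (e * `|d|) *+ N = \sum_(j < N) e * `|d|.
  by rewrite sumr_const card_ord.
apply: ler_sum => j _.
rewrite -mulrBr normrM mulrC; apply: ler_pM => //; first exact: hc.
exact: ler_entry_norm.
Qed.

End directional.

Section smooth.
Context {R : realType} {N M : nat} (p q : R).
Implicit Types (F : R -> 'cV[R]_N -> 'cV[R]_M -> R).

Definition dstate F (j : 'I_N) : R -> 'cV[R]_N -> 'cV[R]_M -> R :=
  fun t y v => 'D_(delta_mx j 0) (fun w => F t w v) y.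

Definition smooth_in_state F : Prop :=
  [/\ forall t y v, t \in `[p, q] -> differentiable (fun w => F t w v) y,
      jointly_continuous p q F
    & forall j, jointly_continuous p q (dstate F j)].

(** Joint continuity of [F] follows by moving first in the state, where locally bounded partial
    derivatives give a Lipschitz bound uniform in [t] and [v], then in time and control at the fixed
    state [y0]. *)
Lemma C1_in_state_smooth F : C1_in_state (W := R) p q F -> smooth_in_state F.
Proof.
case=> Fc Fd Fdc.
have Dc j : jointly_continuous p q (dstate F j).
  exact: within_jointly_continuous (Fdc _).
split=> // t0 y0 v0 t0pq e e0.
have e20 : 0 < e / 2 by rewrite divr_gt0.
have [d d0 dP] : exists2 d, 0 < d & forall t v, t \in `[p, q] -> `|t - t0| < d ->
    `|v - v0| < d -> `|F t y0 v - F t0 y0 v0| < e / 2.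
  have /subspace_continuousP /(_ (t0, v0) t0pq) := Fc y0.
  move=> /cvgrPdist_lt /(_ _ e20) /nbhs_ballP[d /= d0 dP].
  exists d => // t v tpq tt0 vv0; rewrite distrC.
  apply: (dP (t, v)) => //; rewrite /ball /=; split => /=.
    by rewrite -ball_normE /= distrC.
  by rewrite -ball_normE /= distrC.
have [||b b0 bP] := @exists_common_radius R 'I_N (fun j b => forall t y v,
    t \in `[p, q] -> `|t - t0| < b -> `|y - y0| < b -> `|v - v0| < b ->
    `|dstate F j t y v| <= b^-1).
- move=> j b b' b'0 b'b h t y v tpq tb yb vb; apply: (@le_trans _ _ b^-1).
    by apply: h => //; exact: lt_le_trans b'b.
  by rewrite lef_pV2 // posrE (lt_le_trans b'0).
- move=> j; have [b b0 bP] := Dc j t0 y0 v0 t0pq 1 ltr01.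
  set D0 := dstate F j t0 y0 v0 in bP.
  have a0 : 0 < (`|D0| + 1)^-1 by rewrite invr_gt0 ltr_wpDl.
  exists (Num.min b (`|D0| + 1)^-1); first by rewrite lt_min b0.
  move=> t y v tpq; rewrite !lt_min => /andP[tb _] /andP[yb _] /andP[vb _].
  have /ltW h := bP t y v tpq tb yb vb.
  apply: (@le_trans _ _ (`|D0| + 1)).
    have := ler_normD (dstate F j t y v - D0) D0.
    by rewrite subrK; lra.
  rewrite -[leLHS]invrK lef_pV2 ?posrE ?ge_min ?lexx ?orbT //.
  by rewrite lt_min b0.
pose K := N%:R * b^-1.
have K0 : 0 <= K by rewrite mulr_ge0 // ltW // invr_gt0.
(* Makes [K * a] at most [e / 2]; the [+ 1] covers [K = 0]. *)
pose a := (K + 1)^-1 * (e / 2).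
have a0 : 0 < a by rewrite mulr_gt0 // invr_gt0; lra.
exists (Num.min (Num.min d b) a); first by rewrite !lt_min d0 b0.
move=> t y v tpq; rewrite !lt_min -!andbA => /and3P[td tb _] /and3P[yd yb ya].
move=> /and3P[vd vb _].
have h1 := dP t v tpq td vd.
have h2 : `|F t y v - F t y0 v| <= K * `|y - y0|.
  have := @first_order_le R N (fun w => F t w v) y y0 (fun=> 0) b^-1.
  rewrite (_ : \sum_j _ = 0) ?subr0; last by rewrite big1 // => j _; rewrite mulr0.
  apply=> [w|s j /andP[s0 s1]]; first exact: Fd.
  rewrite subr0; apply: (bP j) => //.
  rewrite addrAC subrr add0r normrZ ger0_norm //.
  by apply: le_lt_trans yb; rewrite ler_piMl.
have h3 : K * `|y - y0| < e / 2.
  apply: (@le_lt_trans _ _ ((K + 1) * `|y - y0|)).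
    by rewrite ler_wpM2r //; lra.
  by rewrite mulrC -ltr_pdivlMr 1?mulrC //; lra.
rewrite (_ : _ - _ = (F t y v - F t y0 v) + (F t y0 v - F t0 y0 v0)); last by ring.
by apply: (le_lt_trans (ler_normD _ _)); lra.
Qed.

Lemma C1_in_state_entry (f : R -> 'cV[R]_N -> 'cV[R]_M -> 'cV[R]_N) i :
  C1_in_state p q f -> C1_in_state (W := R) p q (fun t y v => f t y v i 0).
Proof.
case=> fc fd fdc; split.
- move=> y; apply/subspace_continuousP => s spq.
  have /subspace_continuousP /(_ s spq) h := fc y.
  apply: (@cvg_comp _ _ _ (fun s => f s.1 y s.2) (fun m : 'cV[R]_N => m i 0)).
    exact: h.
  exact: coord_continuous.
- move=> t y v tpq.
  apply: (@differentiable_comp _ _ _ _ (fun w => f t w v) (fun m : 'cV[R]_N => m i 0)).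
    exact: fd.
  exact: differentiable_coord.
- move=> e; apply/subspace_continuousP => -[[t y] v] spq.
  have /subspace_continuousP /(_ _ spq) h := fdc e.
  have E (s : R * 'cV[R]_N * 'cV[R]_M) : s.1.1 \in `[p, q] ->
      ('D_e (fun w => f s.1.1 w s.2) s.1.2) i 0 = 'D_e (fun w => f s.1.1 w s.2 i 0) s.1.2.
    move=> sp; have dv : derivable (fun w => f s.1.1 w s.2) s.1.2 e.
      exact/diff_derivable/fd.
    by rewrite (derive_mx dv) mxE.
  rewrite /from_subspace /= -(E (t, y, v)) //=.
  (* Taking an entry commutes with the derivative where [f] is known to be differentiable, that is
     for times in [[p, q]]; the [within] filter sees only those. *)
  apply: (@cvg_trans _ ((fun s : R * 'cV[R]_N * 'cV[R]_M =>
      ('D_e (fun w => f s.1.1 w s.2) s.1.2) i 0) @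
      within [set s | s.1.1 \in `[p, q]] (nbhs (t, y, v)))).
    apply: near_eq_cvg.
    by apply/nbhs_ballP; exists 1 => //= s _ /= sp; rewrite E.
  apply: (@cvg_comp _ _ _ (fun s : R * 'cV[R]_N * 'cV[R]_M =>
      'D_e (fun w => f s.1.1 w s.2) s.1.2) (fun m : 'cV[R]_N => m i 0)).
    exact: h.
  exact: coord_continuous.
Qed.

End smooth.

(** * Column vectors, entry by entry *)

Section column_vectors.
Context {R : realType} {N : nat}.
Implicit Types (v : 'cV[R]_N) (y : R -> 'cV[R]_N).

Lemma norm_le_entry v (B : R) : 0 <= B -> (forall i, `|v i 0| <= B) -> `|v| <= B.
Proof.
move=> B0 vB; rewrite [leLHS]/Num.Def.normr /= mx_normrE.
by apply: bigmax_le => // -[i j] _ /=; rewrite ord1.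
Qed.

Lemma within_itv_entryP (a b : R) y : {within `[a, b], continuous y} <->
  forall i, {within `[a, b], continuous (fun t => y t i 0)}.
Proof.
split=> [yc i|yc]; apply/within_itv_cvgP => t tab e e0.
  have [d d0 dP] := (within_itv_cvgP _ _ _).1 yc t tab e e0.
  exists d => // s sab st; apply: le_lt_trans (dP s sab st).
  by have := ler_entry_norm (y s - y t) i; rewrite !mxE.
have e20 : 0 < e / 2 by rewrite divr_gt0.
have [||d d0 dP] := @exists_common_radius R 'I_N (fun i d => forall s,
    s \in `[a, b] -> `|s - t| < d -> `|y s i 0 - y t i 0| < e / 2).
- by move=> i d d' _ d'd h s sab st; apply: h => //; exact: lt_le_trans d'd.
- by move=> i; exact: (within_itv_cvgP _ _ _).1 (yc i) t tab _ e20.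
exists d => // s sab st; apply: (@le_lt_trans _ _ (e / 2)); last by lra.
apply: norm_le_entry => [|i]; first exact: ltW.
by rewrite !mxE; apply/ltW; exact: dP.
Qed.

Lemma continuous_entry (w : R -> 'cV[R]_N) t i : {for t, continuous w} ->
  {for t, continuous (fun a => w a i 0)}.
Proof.
move=> wc; apply: (@cvg_comp _ _ _ w (fun m : 'cV[R]_N => m i 0)); first exact: wc.
exact: coord_continuous.
Qed.

Lemma entrywise_continuous (y : R -> 'cV[R]_N) t :
  (forall i, {for t, continuous (fun a => y a i 0)}) -> {for t, continuous y}.
Proof.
move=> yc; apply/cvgrPdist_lt => e e0.
have e20 : 0 < e / 2 by rewrite divr_gt0.
have : \forall a \near t, forall i, `|y t i 0 - y a i 0| < e / 2.
  apply: (@filter_forall R 'I_N (fun i a => `|y t i 0 - y a i 0| < e / 2)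
    (nbhs t) (nbhs_filter t)) => i.
  by have /cvgrPdist_lt /(_ _ e20) := yc i.
apply: filterS => a h; apply: (@le_lt_trans _ _ (e / 2)); last by lra.
by apply: norm_le_entry => [|i]; [exact: ltW|rewrite !mxE; exact/ltW/h].
Qed.

Lemma is_derive_entryP y t (dy : 'cV[R]_N) : is_derive t (1 : R) y dy <->
  forall i, is_derive t (1 : R) (fun s => y s i 0) (dy i 0).
Proof.
split=> [[yd yE] i|yd].
  apply: DeriveDef; first exact: (derivable_mxP _ _ _).1.
  by rewrite -yE (derive_mx yd) mxE.
have yder : derivable y t 1.
  by apply/derivable_mxP => i j; rewrite ord1; case: (yd i).
apply: DeriveDef => //; rewrite (derive_mx yder).
apply/matrixP => i j; rewrite mxE ord1.
exact: (@derive_val _ _ _ _ _ _ _ (yd i)).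
Qed.

(** The norm is the maximum of the entries, so the scalar comparison on each entry loses no factor
    depending on [N]. *)
Lemma norm_le_of_derive (s : seq R) y dy (e de : R -> R) (a b : R) :
  a <= b -> {within `[a, b], continuous y} -> {within `[a, b], continuous e} ->
  (forall t, t \in `]a, b[ -> t \notin s ->
    [/\ is_derive t (1 : R) y (dy t), is_derive t (1 : R) e (de t)
      & `|dy t| <= de t]) ->
  0 <= e b -> `|y a| <= e a -> `|y b| <= e b.
Proof.
move=> ab yc ec dye eb ya; apply: norm_le_entry => // i.
apply: (normr_le_of_derive (s := s) (g := fun t => y t i 0) (e := e)
  (dg := fun t => dy t i 0) (de := de) ab) => //.
- exact: (within_itv_entryP _ _ _).1.
- move=> t tab ts; have [h1 h2 h3] := dye t tab ts; split => //.
    exact: (is_derive_entryP _ _ _).1.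
  exact: le_trans (ler_entry_norm _ _) h3.
- exact: le_trans (ler_entry_norm _ _) ya.
Qed.

End column_vectors.

(** The intervals of radius [C * 2^-1 ^+ n] around [u n] meet pairwise, so the supremum of their
    left ends lies in all of them: a limit together with its rate. *)
Lemma geometric_limit {R : realType} (u : nat -> R) (C : R) : 0 <= C ->
  (forall n k, `|u (n + k)%N - u n| <= C * 2^-1 ^+ n) ->
  exists l, forall n, `|l - u n| <= C * 2^-1 ^+ n.
Proof.
move=> C0 uC.
have H n m : u n - C * 2^-1 ^+ n <= u m + C * 2^-1 ^+ m.
  have pos k : 0 <= C * 2^-1 ^+ k :> R by rewrite mulr_ge0 // exprn_ge0.
  have [nm|/ltnW mn] := leqP n m.
    have := uC n (m - n)%N; rewrite subnKC // ler_norml => /andP[h _].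
    by have := pos m; lra.
  have := uC m (n - m)%N; rewrite subnKC // ler_norml => /andP[_ h].
  by have := pos n; lra.
pose S := [set u n - C * 2^-1 ^+ n | n in setT].
have S0 : S !=set0 by exists (u 0%N - C * 2^-1 ^+ 0); exists 0%N.
have Sub : has_ubound S by exists (u 0%N + C * 2^-1 ^+ 0) => _ [n _ <-].
exists (sup S) => n; rewrite ler_distl; apply/andP; split.
  by apply: ub_le_sup => //; exists n.
by apply: ge_sup => // _ [m _ <-].
Qed.

Lemma le0_geometric {R : realType} (a C : R) :
  (forall n, a <= C * 2^-1 ^+ n) -> a <= 0.
Proof.
move=> aC.
have half : `|2^-1 : R| < 1 by rewrite ger0_norm // invf_lt1 // ltr1n.
have h := @cvg_geometric R C 2^-1 half.
rewrite -(cvg_lim (@Rhausdorff R) h); apply: limr_ge; first by apply/cvg_ex; exists 0.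
by near=> n; exact: aC.
Unshelve. all: by end_near. Qed.

Lemma is_derive_affine {R : realType} (k p t : R) :
  is_derive t (1 : R) (fun s => k * (s - p)) k.
Proof.
have -> : (fun s => k * (s - p)) = k *: (id - cst p) by [].
rewrite -[X in is_derive _ _ _ X](_ : k *: (1 - 0) = k); last first.
  by rewrite subr0 [LHS]mulr1.
exact: is_deriveZ.
Qed.

Lemma within_continuous_affine {R : realType} (k p a b : R) :
  {within `[a, b], continuous (fun s => k * (s - p))}.
Proof.
by apply: derivable_within_continuous => t _; have [] := is_derive_affine k p t.
Qed.

Lemma is_derive_expR_shift {R : realType} (C k p t : R) :
  is_derive t (1 : R) (fun s => C * expR (k * (s - p)))
    (C * (k * expR (k * (t - p)))).
Proof.
have -> : (fun s => C * expR (k * (s - p))) = C *: (expR \o (fun s => k * (s - p))).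
  by [].
apply: is_deriveZ; rewrite -[k * expR _]mulrC.
apply: (is_derive1_comp (f := expR) (g := fun s => k * (s - p))).
exact: is_derive_affine.
Qed.

(** * Picard iteration in a tube *)

Section picard.
Context {R : realType} {N : nat} (p q : R) (s : seq R).
Context (g : R -> 'cV[R]_N -> 'cV[R]_N) (z : R -> 'cV[R]_N) (x : 'cV[R]_N).
Context (r K c : R).
Implicit Types (y : R -> 'cV[R]_N).

(** The region where [g] is known to be bounded and Lipschitz. Its axis [z] need not solve the
    equation of [g]; its defect [picard_op z - z] is what counts. *)
Definition in_tube y := {within `[p, q], continuous y} /\
  forall t, t \in `[p, q] -> `|y t - z t| < r.

Definition picard_op y (t : R) : 'cV[R]_N :=
  x + \col_i primitive p (fun a => g a (y a) i 0) t.

Hypothesis pq : p <= q.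
Hypothesis g_bound : forall y, in_tube y ->
  exists B, forall t, t \in `[p, q] -> `|g t (y t)| <= B.
Hypothesis g_cont : forall y, in_tube y -> forall t, t \in `]p, q[ ->
  t \notin s -> {for t, continuous (fun a => g a (y a))}.
Hypothesis g_lip : forall t (y y' : 'cV[R]_N), t \in `[p, q] -> `|y - z t| < r ->
  `|y' - z t| < r -> `|g t y - g t y'| <= K * `|y - y'|.

Let gi_bound y i : in_tube y -> exists B, forall t, t \in `[p, q] ->
  `|g t (y t) i 0| <= B.
Proof.
move=> /g_bound[B yB]; exists B => t tpq.
exact: le_trans (ler_entry_norm _ _) (yB t tpq).
Qed.

Let gi_cont y i : in_tube y -> forall t, t \in `]p, q[ -> t \notin s ->
  {for t, continuous (fun a => g a (y a) i 0)}.
Proof. by move=> yt t tpq ts; apply: continuous_entry; exact: g_cont. Qed.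

Lemma picard_op_continuous y : in_tube y ->
  {within `[p, q], continuous (picard_op y)}.
Proof.
move=> yt; apply/within_itv_entryP => i.
have [B yB] := gi_bound i yt.
have := primitive_continuous yB (gi_cont yt) pq.
move=> /within_itv_cvgP h; apply/within_itv_cvgP => t tpq e e0.
have [d d0 dP] := h t tpq e e0; exists d => // a apq at_.
by have := dP a apq at_; rewrite !mxE opprD addrACA subrr add0r.
Qed.

Lemma picard_op0 y : picard_op y p = x.
Proof.
by apply/matrixP => i j; rewrite !mxE ord1 primitive0 addr0.
Qed.

Lemma is_derive_picard_op y t : in_tube y -> t \in `]p, q[ ->
  {for t, continuous (fun a => g a (y a))} ->
  is_derive t (1 : R) (picard_op y) (g t (y t)).
Proof.
move=> yt tpq gc; apply/is_derive_entryP => i.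
have [B yB] := gi_bound i yt.
have h := is_derive_primitive yB (gi_cont yt) tpq (continuous_entry (i := i) gc).
have -> : (fun a => picard_op y a i 0) =
    cst (x i 0) + primitive p (fun a => g a (y a) i 0).
  by apply/funext => a; rewrite !mxE.
by rewrite -[X in is_derive _ _ _ X]add0r; apply: is_deriveD.
Qed.

Hypothesis K0 : 0 < K.
Hypothesis c0 : 0 <= c.

Let ex (t : R) : R := expR (2 * K * (t - p)).

Let ex_ge1 t : t \in `[p, q] -> 1 <= ex t.
Proof.
rewrite in_itv /= => /andP[pt _]; rewrite -expR0 ler_expR.
by rewrite mulr_ge0 ?subr_ge0 // mulr_ge0 // ltW.
Qed.

Let ex_le t : t \in `[p, q] -> ex t <= ex q.
Proof.
rewrite in_itv /= => /andP[_ tq]; rewrite ler_expR ler_wpM2l //.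
  by rewrite mulr_ge0 // ltW.
by rewrite lerB.
Qed.

(* In the weighted norm sup |y t| / exp (2 K (t - p)) the operator contracts by 1/2
   on all of [p, q], so no restriction to short intervals is needed. *)
Lemma picard_op_contract y y' (D : R) : 0 <= D -> in_tube y -> in_tube y' ->
  (forall t, t \in `[p, q] -> `|y t - y' t| <= D * ex t) ->
  forall t, t \in `[p, q] -> `|picard_op y t - picard_op y' t| <= D / 2 * ex t.
Proof.
move=> D0 yt y't yy' t tpq.
have /andP[pt tq] : p <= t <= q by move: tpq; rewrite in_itv.
have ptq : `[p, t] `<=` `[p, q] by apply: subset_itvl; rewrite bnd_simp.
apply: (norm_le_of_derive (s := s) (y := picard_op y - picard_op y')
  (dy := fun a => g a (y a) - g a (y' a)) (e := fun a => D / 2 * ex a)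
  (de := fun a => D / 2 * (2 * K * ex a)) pt) => //.
- apply: continuous_subspaceW ptq _.
  by apply: within_continuousB; exact: picard_op_continuous.
- apply: derivable_within_continuous => a _.
  exact: (@ex_derive _ _ _ _ _ _ _ (is_derive_expR_shift (D / 2) (2 * K) p a)).
- move=> a; rewrite in_itv /= => /andP[pa at_] as_.
  have apq : a \in `]p, q[ by rewrite in_itv /= pa (lt_le_trans at_).
  have apq' : a \in `[p, q] by rewrite in_itv /= !ltW // (lt_le_trans at_).
  split.
  + by apply: is_deriveB; apply: is_derive_picard_op => //; exact: g_cont.
  + exact: is_derive_expR_shift.
  (* [K * (D * ex a)] is exactly the derivative of [D / 2 * ex a]: the exponent [2 * K] in the
     weight produces the factor 1/2. *)
  + apply: (le_trans (g_lip apq' _ _)); [exact: yt.2|exact: y't.2|].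
    have := yy' a apq'; have := ltW K0; nra.
- by rewrite mulr_ge0 ?divr_ge0 // expR_ge0.
- by rewrite !fctE !picard_op0 subrr normr0 mulr_ge0 ?divr_ge0 // expR_ge0.
Qed.

Hypothesis z_cont : {within `[p, q], continuous z}.
Hypothesis z_defect : forall t, t \in `[p, q] -> `|picard_op z t - z t| <= c.
Hypothesis c_small : 2 * c * ex q < r.

Let Y n : R -> 'cV[R]_N := iter n picard_op z.

Let small_in_tube y (D : R) : D <= 2 * c -> {within `[p, q], continuous y} ->
  (forall t, t \in `[p, q] -> `|y t - z t| <= D * ex t) -> in_tube y.
Proof.
move=> Dc yc yD; split => // t tpq; apply: le_lt_trans c_small.
apply: (le_trans (yD t tpq)); apply: (@le_trans _ _ (2 * c * ex t)).
  by rewrite ler_wpM2r // expR_ge0.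
by rewrite ler_wpM2l ?ex_le // mulr_ge0.
Qed.

Let half_pow n : 0 < (2^-1 : R) ^+ n <= 1.
Proof. by rewrite exprn_gt0 //= exprn_ile1 // invf_le1 // ler1n. Qed.

Let shrink n : 2 * c * (1 - 2^-1 ^+ n) <= 2 * c.
Proof.
have /andP[h0 _] := half_pow n.
by rewrite ler_piMr ?mulr_ge0 // lerBlDr lerDl ltW.
Qed.

(** The increments [c * 2^-1 ^+ k * ex t] for [k < n] sum to [2 * c * (1 - 2^-1 ^+ n) * ex t], which
    [c_small] keeps below [r]. Contraction needs the iterates in the tube and conversely, hence a
    joint induction. *)
Let Y_inv n : [/\ {within `[p, q], continuous (Y n)},
  forall t, t \in `[p, q] -> `|Y n t - z t| <= 2 * c * (1 - 2^-1 ^+ n) * ex t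
  & forall t, t \in `[p, q] -> `|Y n.+1 t - Y n t| <= c * 2^-1 ^+ n * ex t].
Proof.
elim: n => [|n [Yc Yz YS]].
  split => // t tpq; first by rewrite subrr normr0 expr0 subrr mulr0 mul0r.
  apply: (le_trans (z_defect tpq)).
  by rewrite expr0 mulr1 ler_peMr // ex_ge1.
have /andP[h0 h1] := half_pow n.
have tn : in_tube (Y n).
  exact: small_in_tube (shrink n) Yc Yz.
have Yc1 : {within `[p, q], continuous (Y n.+1)} by exact: picard_op_continuous.
have Yz1 t : t \in `[p, q] ->
    `|Y n.+1 t - z t| <= 2 * c * (1 - 2^-1 ^+ n.+1) * ex t.
  move=> tpq; have a1 := Yz t tpq; have a2 := YS t tpq.
  rewrite (_ : Y n.+1 t - z t = (Y n.+1 t - Y n t) + (Y n t - z t)); last by rewrite addrA subrK.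
  apply: (le_trans (ler_normD _ _)); rewrite exprS; lra.
have tn1 : in_tube (Y n.+1).
  exact: small_in_tube (shrink n.+1) Yc1 Yz1.
split => // t tpq.
rewrite exprSr mulrA; apply: picard_op_contract => //.
by rewrite mulr_ge0 // ltW.
Qed.

Let Y_tube n : in_tube (Y n).
Proof.
by have [Yc Yz _] := Y_inv n; exact: small_in_tube (shrink n) Yc Yz.
Qed.

Let Y_dist n k t : t \in `[p, q] ->
  `|Y (n + k)%N t - Y n t| <= 2 * c * 2^-1 ^+ n * (1 - 2^-1 ^+ k) * ex t.
Proof.
move=> tpq; elim: k => [|k IH].
  by rewrite addn0 subrr normr0 expr0 subrr mulr0 mul0r.
have [_ _ /(_ t tpq) h] := Y_inv (n + k)%N.
rewrite addnS (_ : Y (n + k).+1 t - Y n t =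
  (Y (n + k).+1 t - Y (n + k)%N t) + (Y (n + k)%N t - Y n t)); last by rewrite addrA subrK.
apply: (le_trans (ler_normD _ _)); rewrite exprS; rewrite exprD in h; lra.
Qed.

Lemma picard : exists y, [/\ {within `[p, q], continuous y}, y p = x,
  forall t, t \in `[p, q] -> `|y t - z t| <= 2 * c * ex q
  & forall t, t \in `]p, q[ -> {for t, continuous (fun a => g a (y a))} ->
      is_derive t (1 : R) y (g t (y t))].
Proof.
have /choice[y yP] (t : R) : exists v : 'cV[R]_N, t \in `[p, q] ->
    forall n, `|v - Y n t| <= 2 * c * ex t * 2^-1 ^+ n.
  have [tpq|] := boolP (t \in `[p, q]); last by exists 0.
  have C0 : 0 <= 2 * c * ex t by rewrite !mulr_ge0 // expR_ge0.
  have /choice[v vP] (i : 'I_N) : exists l, forall n,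
      `|l - Y n t i 0| <= 2 * c * ex t * 2^-1 ^+ n.
    apply: geometric_limit => // n k.
    have := ler_entry_norm (Y (n + k)%N t - Y n t) i; rewrite !mxE => /le_trans; apply.
    apply: (le_trans (Y_dist n k tpq)).
    have /andP[h0 _] := half_pow k.
    rewrite [leRHS]mulrAC ler_wpM2r ?expR_ge0 //; apply: ler_piMr.
      by rewrite !mulr_ge0 // exprn_ge0.
    by rewrite lerBlDr lerDl ltW.
  exists (\col_i v i) => _ n; apply: norm_le_entry => [|i].
    by rewrite mulr_ge0 // exprn_ge0.
  by rewrite !mxE.
have yc : {within `[p, q], continuous y}.
  apply/within_itv_cvgP => t tpq e e0.
  have C0 : 0 <= 2 * c * ex q by rewrite !mulr_ge0 // expR_ge0.
  have [n nP] : exists n, 2 * c * ex q * 2^-1 ^+ n < e / 3.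
    apply: contrapT => /forallNP h.
    have : e / 3 <= 0 by apply: (@le0_geometric _ _ (2 * c * ex q)) => n; rewrite leNgt; exact/negP.
    by lra.
  have close a : a \in `[p, q] -> `|y a - Y n a| < e / 3.
    move=> apq; apply: le_lt_trans nP; apply: (le_trans (yP a apq n)).
    by rewrite ler_wpM2r ?exprn_ge0 // ler_wpM2l ?ex_le // mulr_ge0.
  have e30 : 0 < e / 3 by lra.
  have [Yc _ _] := Y_inv n.
  have [d d0 dP] := (within_itv_cvgP _ _ _).1 Yc t tpq _ e30.
  exists d => // a apq at_; have h1 := dP a apq at_.
  have h2 := close a apq; have h3 := close t tpq.
  rewrite (_ : y a - y t = (y a - Y n a) + (Y n a - Y n t) - (y t - Y n t)).
    apply: (le_lt_trans (ler_normB _ _)).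
    by have := ler_normD (y a - Y n a) (Y n a - Y n t); lra.
  by rewrite opprB addrA [in RHS]addrA !subrK.
have yz t : t \in `[p, q] -> `|y t - z t| <= 2 * c * ex t.
  by move=> tpq; have := yP t tpq 0%N; rewrite expr0 mulr1.
have ty : in_tube y by exact: small_in_tube (lexx _) yc yz.
(* Both sides are close to [Y n.+1], which is [picard_op (Y n)]; the two errors are halves of
   [2 * c * ex t * 2^-1 ^+ n]. *)
have fixed t : t \in `[p, q] -> picard_op y t = y t.
  move=> tpq; apply/eqP; rewrite -subr_eq0 -normr_le0.
  apply: (@le0_geometric _ _ (2 * c * ex t)) => n.
  have h1 := yP t tpq n.+1.
  have h2 : `|picard_op y t - Y n.+1 t| <= 2 * c * 2^-1 ^+ n / 2 * ex t.
    apply: picard_op_contract => //.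
      by rewrite !mulr_ge0 // exprn_ge0.
    by move=> a apq; have := yP a apq n; rewrite mulrAC.
  rewrite (_ : _ - _ = (picard_op y t - Y n.+1 t) - (y t - Y n.+1 t)); last first.
    by rewrite opprB addrA subrK.
  by apply: (le_trans (ler_normB _ _)); rewrite exprS in h1; lra.
exists y; split => //.
- by rewrite -fixed ?picard_op0 // in_itv /= lexx.
- by move=> t tpq; apply: (le_trans (yz t tpq)); rewrite ler_wpM2l ?ex_le // mulr_ge0.
- move=> t tpq gc.
  (* [y] and its image agree only on [[p, q]], which is a neighbourhood of the interior time [t]. *)
  apply: (@near_eq_is_derive _ _ _ (picard_op y)); last exact: is_derive_picard_op.
  near=> a; apply: fixed; apply: subset_itv_oo_cc.
  by near: a; exact: near_in_itvoo.
Unshelve. all: by end_near. Qed.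

End picard.

(** * Piecewise continuous controls and needles *)

Lemma nbhs_itv_oo_cc {R : realType} (p q t : R) : t \in `]p, q[ ->
  nbhs t [set` `[p, q]].
Proof.
move=> tpq; apply: filterS (near_in_itvoo tpq) => a; exact: subset_itv_oo_cc.
Qed.

Section controls.
Context {R : realType} {N M : nat} (p q : R).
Implicit Types (u : R -> 'cV[R]_M).

Lemma continuous_comp_joint {V U : normedModType R} (F : R -> V -> U -> R)
    (y : R -> V) (v : R -> U) t :
  jointly_continuous p q F -> t \in `]p, q[ ->
  {for t, continuous y} -> {for t, continuous v} ->
  {for t, continuous (fun a => F a (y a) (v a))}.
Proof.
move=> Fc tpq /cvgrPdist_lt yc /cvgrPdist_lt vc.
apply/cvgrPdist_lt => e e0.
have tpq' : t \in `[p, q] by exact: subset_itv_oo_cc.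
have [d d0 dP] := Fc t (y t) (v t) tpq' e e0.
near=> a; rewrite distrC; apply: dP.
- by apply: subset_itv_oo_cc; near: a; exact: near_in_itvoo.
- by near: a; apply/nbhs_ballP; exists d => //= a; rewrite /ball /= distrC.
- by rewrite distrC; near: a; exact: yc.
- by rewrite distrC; near: a; exact: vc.
Unshelve. all: by end_near. Qed.

Lemma piecewise_continuousE u : piecewise_continuous p q u ->
  exists s : seq R, forall t, t \in `]p, q[ -> t \notin s -> {for t, continuous u}.
Proof.
move=> [s _ sP]; exists s => t tpq ts.
have := sP t (subset_itv_oo_cc tpq); rewrite (negbTE ts).
by rewrite within_interior //; exact: nbhs_itv_oo_cc.
Qed.

Lemma piecewise_continuous_cst (w : 'cV[R]_M) : piecewise_continuous p q (fun=> w).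
Proof. by exists [::] => // t _ /=; exact: cvg_cst. Qed.

Definition needle (a : R) (w : 'cV[R]_M) u : R -> 'cV[R]_M :=
  fun t => if t < a then w else u t.

(** The only new break is [a]. Breaks of [u] before [a] stay in the list, which is harmless: both
    one-sided limits there are [w]. *)
Lemma piecewise_continuous_needle a w u : a \in `]p, q[ ->
  piecewise_continuous p q u -> piecewise_continuous p q (needle a w u).
Proof.
move=> apq [s ss sP]; exists (a :: s).
  by move=> t; rewrite inE => /predU1P[->//|/ss].
have before t : t < a -> \forall b \near t, w = needle a w u b.
  by move=> ta; apply: filterS (lt_nbhsl ta) => b ba; rewrite /needle ba.
have after t : a < t -> \forall b \near t, u b = needle a w u b.
  by move=> ta; apply: filterS (lt_nbhsr ta) => b ab; rewrite /needle ltNge ltW.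
have right : \forall b \near a^'+, u b = needle a w u b.
  apply: filterS (nbhs_right_gt a) => b ab.
  by rewrite /needle ltNge ltW.
have left : \forall b \near a^'-, w = needle a w u b.
  by apply: filterS (nbhs_left_lt a) => b ab; rewrite /needle ab.
have cvgw (F : set_system R) : Filter F -> (\forall b \near F, w = needle a w u b) ->
    needle a w u @ F --> w.
  by move=> FF h; apply: (@cvg_trans _ ((fun=> w) @ F)); [exact: near_eq_cvg|exact: cvg_cst].
have cvgu (F : set_system R) l : Filter F -> (\forall b \near F, u b = needle a w u b) ->
    u @ F --> l -> needle a w u @ F --> l.
  by move=> FF h; apply: (@cvg_trans _ (u @ F)); exact: near_eq_cvg.
move=> t tpq; rewrite inE; case: (ltgtP t a) => [ta|ta|->] /=.
- have h := before t ta.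
  have {}cvgw (F : set_system R) : Filter F -> F `=>` nbhs t -> needle a w u @ F --> w.
    by move=> FF Ft; apply: cvgw; exact: Ft.
  case: ifP => _.
    by split; apply/cvg_ex; exists w; apply: cvgw; exact: cvg_within.
  by rewrite {2}/needle ta; apply: cvgw; exact: cvg_within.
- have h := after t ta.
  have {}cvgu (F : set_system R) l : Filter F -> F `=>` nbhs t -> u @ F --> l ->
      needle a w u @ F --> l.
    by move=> FF Ft; apply: cvgu; exact: Ft.
  have := sP t tpq; case: ifP => _.
    move=> [/cvg_ex[l1 h1] /cvg_ex[l2 h2]].
    by split; apply/cvg_ex; [exists l1|exists l2]; apply: cvgu => //; exact: cvg_within.
  have -> : needle a w u t = u t by rewrite /needle ltNge ltW.
  by apply: cvgu; exact: cvg_within.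
(* At [a] the left limit is [w]; the right limit is that of [u] if [u] breaks there too, and [u a]
   otherwise. *)
- split; first by apply/cvg_ex; exists w; exact: cvgw.
  have := sP a (subset_itv_oo_cc apq); case: ifP => _.
    by move=> [_ /cvg_ex[l h]]; apply/cvg_ex; exists l; exact: cvgu.
  rewrite within_interior; last exact: nbhs_itv_oo_cc.
  move=> h; apply/cvg_ex; exists (u a); apply: cvgu => //.
  by apply: cvg_trans h; apply: cvg_fmap2; exact: cvg_within.
Qed.

End controls.

Lemma differentiable_first_order {R : realType} {N : nat} (T : 'cV[R]_N -> R)
    (y0 : 'cV[R]_N) (e : R) : differentiable T y0 -> 0 < e ->
  exists2 r, 0 < r & forall y, `|y - y0| < r ->
    `|T y - T y0 - \sum_j (y - y0) j 0 * 'D_(delta_mx j 0) T y0| <= e * `|y - y0|.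
Proof.
move=> Td e0; have /eqaddoP h := diff_locally Td.
have /nbhs_ballP[r /= r0 rP] := h e e0.
exists r => // y yr.
have /= := rP (y - y0); rewrite -ball_normE /= sub0r normrN => /(_ yr).
by rewrite !fctE /= subrK opprD addrA -deriveE // derive_sum_entry.
Qed.

(** * The needle variation *)

Section needle_variation.
Context {R : realType} {N M : nat} (p q : R).
Context (f : R -> 'cV[R]_N -> 'cV[R]_M -> 'cV[R]_N).
Context (L : R -> 'cV[R]_N -> 'cV[R]_M -> R) (T : 'cV[R]_N -> R).
Context (x : 'cV[R]_N) (u : R -> 'cV[R]_M) (z lam : R -> 'cV[R]_N) (w : 'cV[R]_M).

Definition hamiltonian (t : R) (y : 'cV[R]_N) (v : 'cV[R]_M) : R :=
  \sum_i lam t i 0 * f t y v i 0 + L t y v.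

Hypothesis pq : p < q.
Hypothesis f_smooth : forall i, smooth_in_state p q (fun t y v => f t y v i 0).
Hypothesis L_smooth : smooth_in_state p q L.
Hypothesis T_diff : differentiable T (z q).
Hypothesis u_pc : piecewise_continuous p q u.
Hypothesis z_state : state p q f x u z.
Hypothesis lam_adj : adjoint_state p q f L T u z lam.
Hypothesis u_min : minimises p q f L T x u z.

Let pq' : p <= q. Proof. exact: ltW. Qed.
Let p_in : p \in `[p, q]. Proof. by rewrite in_itv /= lexx pq'. Qed.
Let q_in : q \in `[p, q]. Proof. by rewrite in_itv /= lexx pq'. Qed.

Let hamE t v : (fun y => hamiltonian t y v) =
  (\sum_i (lam t i 0 *: (fun y => f t y v i 0))) + (fun y => L t y v).
Proof. by apply/funext => y; rewrite fctE fct_sumE. Qed.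

Let hamd_diff t v y : t \in `[p, q] ->
  differentiable (\sum_i (lam t i 0 *: (fun y => f t y v i 0))) y.
Proof.
move=> tpq; apply: differentiable_sum => i; apply: differentiableZ.
by have [fd _ _] := f_smooth i; exact: fd.
Qed.

Lemma dstate_hamiltonian j t y v : t \in `[p, q] ->
  dstate hamiltonian j t y v =
  \sum_i lam t i 0 * dstate (fun t y v => f t y v i 0) j t y v + dstate L j t y v.
Proof.
move=> tpq; have [Ld _ _] := L_smooth.
have fder i : derivable (fun y => f t y v i 0) y (delta_mx j 0).
  by have [fd _ _] := f_smooth i; exact/diff_derivable/fd.
rewrite /dstate hamE deriveD; last 2 first.
- exact/diff_derivable/hamd_diff.
- exact/diff_derivable/Ld.
congr (_ + _); rewrite derive_sum; last by move=> i; exact: derivableZ.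
by apply: eq_bigr => i _; rewrite deriveZ.
Qed.

Lemma hamiltonian_smooth : smooth_in_state p q hamiltonian.
Proof.
have [Ld Lc Ldc] := L_smooth.
have lc i : {within `[p, q], continuous (fun t => lam t i 0)}.
  by apply: (within_itv_entryP _ _ _).1; have [[]] := lam_adj.
split.
- move=> t y v tpq; rewrite hamE; apply: differentiableD; first exact: hamd_diff.
  exact: Ld.
- apply: jointly_continuousD => //; apply: jointly_continuous_sum => i.
  apply: jointly_continuousM; first exact: jointly_continuous_time.
  by have [] := f_smooth i.
- move=> j t0 y0 v0 t0pq e e0.
  have : jointly_continuous p q (fun t y v =>
    \sum_i lam t i 0 * dstate (fun t y v => f t y v i 0) j t y v + dstate L j t y v).
    apply: jointly_continuousD => //; apply: jointly_continuous_sum => i.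
    apply: jointly_continuousM; first exact: jointly_continuous_time.
    by have [_ _] := f_smooth i.
  move=> /(_ t0 y0 v0 t0pq e e0)[d d0 dP]; exists d => // t y v tpq tt yy vv.
  by rewrite !dstate_hamiltonian //; exact: dP.
Qed.

(** At each time a needle agrees with one of these two controls, so bounds for both hold for every
    needle, uniformly in the switching time [a]. *)
Let ctl (b : bool) : R -> 'cV[R]_M := if b then fun=> w else u.

Let ctl_pc b : piecewise_continuous p q (ctl b).
Proof. by case: b => //; exact: piecewise_continuous_cst. Qed.

Let needleE a t : needle a w u t = ctl (t < a) t.
Proof. by rewrite /needle /ctl; case: ifP. Qed.

(* [None] stands for the running loss in [data] and for no derivative in [jet]. *)
Let data (o : option 'I_N) : R -> 'cV[R]_N -> 'cV[R]_M -> R :=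
  if o is Some i then fun t y v => f t y v i 0 else L.

Let jet (o k : option 'I_N) : R -> 'cV[R]_N -> 'cV[R]_M -> R :=
  if k is Some j then dstate (data o) j else data o.

Let data_smooth o : smooth_in_state p q (data o).
Proof. by case: o. Qed.

Let z_cont : {within `[p, q], continuous z}.
Proof. by have [[]] := z_state. Qed.

Let zp : z p = x. Proof. by have [] := z_state. Qed.

(** [r^-1] bounds the entries of [f], the running loss and all their state derivatives in the tube,
    hence also gives Lipschitz constants there. *)
Definition tube_radius (r : R) : Prop := forall b o k t y, t \in `[p, q] ->
  `|y - z t| < r -> `|jet o k t y (ctl b t)| <= r^-1.

Lemma exists_tube_radius : exists2 r, 0 < r & tube_radius r.
Proof.
pose P (i : bool * option 'I_N * option 'I_N) (r : R) := forall t y, t \in `[p, q] ->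
  `|y - z t| < r -> `|jet i.1.2 i.2 t y (ctl i.1.1 t)| <= r^-1.
have [||r r0 rP] := @exists_common_radius R _ P.
- move=> i r r' r'0 r'r h t y tpq yt.
  apply: (le_trans (h t y tpq (lt_le_trans yt r'r))).
  by rewrite lef_pV2 // posrE (lt_le_trans r'0).
- move=> [[b o] k]; apply: tube_bounded => //=.
  by have [_ h1 h2] := data_smooth o; case: k => /=.
- by exists r => // b o k; exact: (rP (b, o, k)).
Qed.

Section fixed_radius.
Context (r : R) (r0 : 0 < r) (rP : tube_radius r).

Let B : R := r^-1.
Let B0 : 0 < B. Proof. by rewrite invr_gt0. Qed.
(** [N%:R * B] is the Lipschitz constant from the mean value theorem; [+ 1] supplies the strict
    positivity that [picard] asks for. *)
Let K : R := N%:R * B + 1.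
Let K0 : 0 < K. Proof. by rewrite ltr_wpDl // mulr_ge0 // ltW. Qed.

Let data_lip b o t y y' : t \in `[p, q] -> `|y - z t| < r -> `|y' - z t| < r ->
  `|data o t y (ctl b t) - data o t y' (ctl b t)| <= K * `|y - y'|.
Proof.
move=> tpq yr y'r.
have := @first_order_le R N (fun a => data o t a (ctl b t)) y y' (fun=> 0) B.
rewrite (_ : \sum_j _ = 0) ?subr0; last by rewrite big1 // => j _; rewrite mulr0.
have [dd _ _] := data_smooth o.
move=> /(_ (fun a => dd t a _ tpq)) h; apply: le_trans (h _) _.
  move=> s j /andP[s0 s1]; rewrite subr0; apply: (rP b o (Some j) tpq).
  rewrite (_ : _ - _ = s *: (y - z t) + (1 - s) *: (y' - z t)); last first.
    by apply/matrixP => i k; rewrite !mxE; ring.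
  apply: (le_lt_trans (ler_normD _ _)); rewrite !normrZ !ger0_norm ?subr_ge0 //.
  (* Balls are convex. For the strict inequality the first summand is used when [0 < s], and the
     point is [y'] when [s = 0]. *)
  have [->|sn] := eqVneq s 0; first by rewrite mul0r add0r subr0 mul1r.
  have sp : 0 < s by rewrite lt_neqAle eq_sym sn.
  apply: (@lt_le_trans _ _ (s * r + (1 - s) * r)); last by rewrite -mulrDl subrKC mul1r.
  by rewrite ltr_leD // ?ltr_pM2l // ler_wpM2l ?subr_ge0 // ltW.
by rewrite ler_wpM2r // /K lerDl.
Qed.

Let f_lip b t y y' : t \in `[p, q] -> `|y - z t| < r -> `|y' - z t| < r ->
  `|f t y (ctl b t) - f t y' (ctl b t)| <= K * `|y - y'|.
Proof.
move=> tpq yr y'r; apply: norm_le_entry => [|i].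
  by rewrite mulr_ge0 // ltW.
by rewrite !mxE; exact: (data_lip b (Some i)).
Qed.

Let f_bound b t y : t \in `[p, q] -> `|y - z t| < r -> `|f t y (ctl b t)| <= B.
Proof.
move=> tpq yr; apply: norm_le_entry => [|i]; first exact: ltW.
exact: (rP b (Some i) None tpq yr).
Qed.

Let z_tube t : `|z t - z t| < r. Proof. by rewrite subrr normr0. Qed.

Let f_comp_cont (y : R -> 'cV[R]_N) (v : R -> 'cV[R]_M) t :
  {within `[p, q], continuous y} -> t \in `]p, q[ -> {for t, continuous v} ->
  {for t, continuous (fun a => f a (y a) (v a))}.
Proof.
move=> yc tpq vc; apply: entrywise_continuous => i.
have [_ fc _] := f_smooth i.
by apply: (continuous_comp_joint fc) => //; exact: within_continuous_continuous yc tpq.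
Qed.

(** The defect of [z] for the needle equation is at most [2 * B * (a - p)]; [picard] multiplies it
    by 2 and by the exponential weight at [q]. *)
Definition gain : R := 4 * B * expR (2 * K * (q - p)).

Lemma gain_gt0 : 0 < gain.
Proof. by rewrite /gain !mulr_gt0 // expR_gt0. Qed.

(** Up to [a] the two right-hand sides along [z] are each bounded by [B], so the defect of [z] grows
    at rate at most [2 * B]. *)
Lemma perturbed_state a : a \in `]p, q[ -> gain * (a - p) < r ->
  exists y, state p q f x (needle a w u) y /\
    forall t, t \in `[p, q] -> `|y t - z t| <= gain * (a - p).
Proof.
rewrite in_itv /= => /andP[pa aq] small.
have apq : a \in `]p, q[ by rewrite in_itv /= pa.
have u'_pc := piecewise_continuous_needle w apq u_pc.
have [s sP] := piecewise_continuousE u_pc.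
have [s' s'P] := piecewise_continuousE u'_pc.
pose g t y := f t y (needle a w u t).
have gb y : in_tube p q z r y ->
    exists B, forall t, t \in `[p, q] -> `|g t (y t)| <= B.
  move=> [_ yt]; exists B => t tpq; rewrite /g needleE; apply: f_bound => //.
  exact: yt.
have gc y : in_tube p q z r y -> forall t, t \in `]p, q[ -> t \notin s' ->
    {for t, continuous (fun a => g a (y a))}.
  by move=> [yc _] t tpq ts; apply: f_comp_cont => //; exact: s'P.
have zt : in_tube p q z r z by split.
have defect t : t \in `[p, q] ->
    `|picard_op p g x z t - z t| <= 2 * B * (a - p).
  move=> tpq; have /andP[pt tq] : p <= t <= q by move: tpq; rewrite in_itv.
  pose D := picard_op p g x z - z.
  have Dc : {within `[p, q], continuous D}.
    by apply: within_continuousB => //; exact: (picard_op_continuous pq' gb gc zt).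
  have dD c : c \in `]p, q[ -> c \notin s ++ s' ->
      is_derive c (1 : R) D (g c (z c) - f c (z c) (u c)).
    rewrite mem_cat negb_or => cpq /andP[cs cs']; apply: is_deriveB.
      by apply: (is_derive_picard_op x gb gc) => //; exact: gc.
    by have [[_ zd] _] := z_state; apply: zd => //; exact: sP.
  have early b : b \in `[p, q] -> b <= a -> `|D b| <= 2 * B * (b - p).
    rewrite in_itv /= => /andP[pb bq] ba.
    apply: (norm_le_of_derive (s := s ++ s') (y := D)
      (dy := fun c => g c (z c) - f c (z c) (u c))
      (e := fun c => 2 * B * (c - p)) (de := fun=> 2 * B) pb) => //.
    + by apply: continuous_subspaceW Dc; apply: subset_itvl; rewrite bnd_simp.
    + exact: within_continuous_affine.
    + move=> c; rewrite in_itv /= => /andP[pc cb] cs.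
      have cpq : c \in `]p, q[ by rewrite in_itv /= pc (lt_le_trans cb).
      have cpq' := subset_itv_oo_cc cpq.
      split; [exact: dD|exact: is_derive_affine|].
      rewrite /g needleE; apply: (le_trans (ler_normB _ _)).
      have h1 := f_bound (c < a) cpq' (z_tube c).
      have h2 := f_bound false cpq' (z_tube c).
      by rewrite mulr2n mulrDl mul1r lerD.
    + by rewrite mulr_ge0 ?subr_ge0 // mulr_ge0 // ltW.
    + rewrite /D !fctE (picard_op0 p g x z) zp subrr normr0.
      by rewrite subrr mulr0.
  have [ta|/ltW at_] := leP t a.
    apply: (le_trans (early t tpq ta)).
    by rewrite ler_wpM2l ?mulr_ge0 ?lerB // ltW.
  (* After [a] the controls agree, the defect has derivative zero, and its bound at [a] persists. *)
  apply: (norm_le_of_derive (s := s ++ s') (y := D)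
      (dy := fun c => g c (z c) - f c (z c) (u c))
      (e := fun=> 2 * B * (a - p)) (de := fun=> 0) at_) => //.
  + apply: continuous_subspaceW Dc; apply: subset_itv; rewrite bnd_simp //.
    exact: ltW.
  + by move=> c; exact: cvg_cst.
  + move=> c; rewrite in_itv /= => /andP[ac ct] cs.
    split; last by rewrite /g needleE ltNge (ltW ac) /= subrr normr0.
      by apply: dD => //; rewrite in_itv /= (lt_trans pa) // (lt_le_trans ct).
    exact: is_derive_cst.
  + by rewrite mulr_ge0 ?subr_ge0 ?mulr_ge0 // ltW.
  + by apply: early => //; exact: subset_itv_oo_cc.
have gl t (y y' : 'cV[R]_N) : t \in `[p, q] -> `|y - z t| < r -> `|y' - z t| < r ->
    `|g t y - g t y'| <= K * `|y - y'|.
  by rewrite /g needleE; exact: f_lip.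
have c0 : 0 <= 2 * B * (a - p) by rewrite mulr_ge0 ?subr_ge0 ?mulr_ge0 // ltW.
have gainE : 2 * (2 * B * (a - p)) * expR (2 * K * (q - p)) = gain * (a - p).
  by rewrite /gain; ring.
have c_small : 2 * (2 * B * (a - p)) * expR (2 * K * (q - p)) < r by rewrite gainE.
have [y [yc yp yz yd]] := picard pq' gb gc gl K0 c0 z_cont defect c_small.
exists y; split; last by move=> t tpq; rewrite -gainE; exact: yz.
split => //; split => // t tpq uc.
by apply: yd => //; apply: f_comp_cont.
Qed.

Let rate (y : R -> 'cV[R]_N) (u' : R -> 'cV[R]_M) (t : R) : R :=
  hamiltonian t (y t) (u' t) - hamiltonian t (z t) (u t) -
  \sum_j (y t - z t) j 0 * dstate hamiltonian j t (z t) (u t).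

(* The multiplier cancels the first-order effect of y - z on the running loss,
   so only the difference of Hamiltonians remains in the derivative. *)
Lemma loss_variation a y : a \in `]p, q[ -> state p q f x (needle a w u) y ->
  (forall t, t \in `[p, q] -> `|y t - z t| < r) ->
  exists (phi : R -> R) (s : seq R), [/\ {within `[p, q], continuous phi}, phi p = 0,
    forall t, t \in `]p, q[ -> t \notin s ->
      is_derive t (1 : R) phi (rate y (needle a w u) t)
    & total_loss p q L T (needle a w u) y - total_loss p q L T u z =
      phi q + (T (y q) - T (z q) -
               \sum_j (y q - z q) j 0 * 'D_(delta_mx j 0) T (z q))].
Proof.
move=> apq [[yc yd] yp] yr.
have [s sP] := piecewise_continuousE u_pc.
have [s' s'P] := piecewise_continuousE (piecewise_continuous_needle w apq u_pc).
set u' := needle a w u in yd s'P *.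
have [_ Lc _] := L_smooth.
have [[lamc lamd] lamq] := lam_adj.
pose ly t := L t (y t) (u' t); pose lz t := L t (z t) (u t).
have lyb t : t \in `[p, q] -> `|ly t| <= B.
  by move=> tpq; rewrite /ly /u' needleE; apply: (rP (t < a) None None tpq); exact: yr.
have lzb t : t \in `[p, q] -> `|lz t| <= B.
  by move=> tpq; exact: (rP false None None tpq (z_tube t)).
have lyc t : t \in `]p, q[ -> t \notin s' -> {for t, continuous ly}.
  move=> tpq ts; apply: (continuous_comp_joint Lc) => //; last exact: s'P.
  exact: within_continuous_continuous yc tpq.
have lzc t : t \in `]p, q[ -> t \notin s -> {for t, continuous lz}.
  move=> tpq ts; apply: (continuous_comp_joint Lc) => //; last exact: sP.
  exact: within_continuous_continuous z_cont tpq.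
pose phi := (\sum_i ((fun t => lam t i 0) * (fun t => (y t - z t) i 0))) +
  (primitive p ly - primitive p lz).
have dc : {within `[p, q], continuous (fun t => y t - z t)}.
  exact: within_continuousB.
exists phi, (s ++ s'); split.
- apply: within_continuousD; last first.
    by apply: within_continuousB; [exact: primitive_continuous lyb lyc pq'
                                  |exact: primitive_continuous lzb lzc pq'].
  have lamic := (within_itv_entryP _ _ _).1 lamc.
  have dic := (within_itv_entryP _ _ _).1 dc.
  elim/big_ind: _ => [|g h gc hc|i _].
  + by move=> t; exact: cvg_cst.
  + exact: within_continuousD.
  + apply/subspace_continuousP => t tpq; apply: cvgM.
      by have /subspace_continuousP := lamic i; exact.
    by have /subspace_continuousP := dic i; exact.
- rewrite /phi !fctE fct_sumE !primitive0 subrr addr0 big1 // => i _.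
  by rewrite !fctE yp zp subrr mxE mulr0.
- move=> t tpq; rewrite mem_cat negb_or => /andP[ts ts'].
  have uc := sP t tpq ts; have u'c := s'P t tpq ts'.
  have tpq' := subset_itv_oo_cc tpq.
  have dly := is_derive_primitive lyb lyc tpq (lyc t tpq ts').
  have dlz := is_derive_primitive lzb lzc tpq (lzc t tpq ts).
  (* The adjoint equation says that the derivative of [lam] is minus the state gradient of the
     Hamiltonian. *)
  have dlam i : is_derive t (1 : R) (fun t => lam t i 0)
      (- dstate hamiltonian i t (z t) (u t)).
    have := (is_derive_entryP _ _ _).1 (lamd t tpq uc) i.
    rewrite dstate_hamiltonian // !mxE.
    under [X in - (X + _)]eq_bigr do rewrite !mxE mulrC.
    by [].
  have dd i : is_derive t (1 : R) (fun t => (y t - z t) i 0)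
      ((f t (y t) (u' t) - f t (z t) (u t)) i 0).
    have [[_ zd] _] := z_state.
    have h : is_derive t (1 : R) (y - z) (f t (y t) (u' t) - f t (z t) (u t)).
      by apply: is_deriveB; [exact: yd|exact: zd].
    exact: (is_derive_entryP _ _ _).1 h i.
  have -> : rate y u' t = \sum_i (lam t i 0 *: (f t (y t) (u' t) - f t (z t) (u t)) i 0
      + (y t - z t) i 0 *: - dstate hamiltonian i t (z t) (u t)) + (ly t - lz t).
    rewrite /rate {1 2}/hamiltonian /ly /lz.
    rewrite [X in _ = X + _](eq_bigr (fun i => lam t i 0 * f t (y t) (u' t) i 0 -
        lam t i 0 * f t (z t) (u t) i 0 -
        (y t - z t) i 0 * dstate hamiltonian i t (z t) (u t))).
      by rewrite !sumrB; ring.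
    by move=> i _; rewrite !mxE /GRing.scale /=; ring.
  apply: is_deriveD; apply: is_derive_sum => i; exact: is_deriveM.
- rewrite /total_loss /phi !fctE fct_sumE.
  (* By the terminal condition on [lam], the boundary term of [phi] is the first-order variation of
     the terminal loss. *)
  have -> : \sum_i ((fun t => lam t i 0) * (fun t => (y t - z t) i 0)) q =
      \sum_j (y q - z q) j 0 * 'D_(delta_mx j 0) T (z q).
    by apply: eq_bigr => i _; rewrite fctE lamq [grad _ _ _ _]mxE mulrC.
  by rewrite /primitive; ring.
Qed.

(** Each summand of the constant is one error, in units of [e] times the needle length: 3 for the
    three terms of [rate] on the needle, [N%:R * gain * (q - p)] for the Taylor remainder of the
    Hamiltonian afterwards, [gain] for that of the terminal loss. *)
Lemma variation_estimate e : 0 < e ->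
  hamiltonian p x (u p) - hamiltonian p x w <=
  e * (3 + N%:R * gain * (q - p) + gain).
Proof.
move=> e0.
have gain0 := gain_gt0.
have [hd hc hdc] := hamiltonian_smooth.
set H := hamiltonian in hd hc hdc *.
(* [r1] controls the oscillation of the state gradient of [H] after the needle, [r2] below its size
   during the needle. *)
have [||r1 r10 r1P] := @exists_common_radius R 'I_N (fun j r => forall t y,
    t \in `[p, q] -> `|y - z t| < r ->
    `|dstate H j t y (u t) - dstate H j t (z t) (u t)| < e).
- by move=> i c c' c'0 c'c h t y tpq yt; apply: h => //; exact: lt_le_trans c'c.
- by move=> j; exact: tube_close.
have [||r2 r20 r2P] := @exists_common_radius R 'I_N (fun j r => forall t y,
    t \in `[p, q] -> `|y - z t| < r -> `|dstate H j t y (u t)| <= r^-1).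
- move=> i c c' c'0 c'c h t y tpq yt.
  apply: (le_trans (h t y tpq (lt_le_trans yt c'c))).
  by rewrite lef_pV2 // posrE (lt_le_trans c'0).
- by move=> j; exact: tube_bounded.
have [r3 r30 r3P] := differentiable_first_order T_diff e0.
have [d1 d10 d1P] := hc p x w p_in e e0.
have [d2 d20 d2P] := hc p x (u p) p_in e e0.
pose d := Num.min d1 d2; have d0 : 0 < d by rewrite lt_min d10.
have [dd1 dd2] : d <= d1 /\ d <= d2 by rewrite /d !ge_min !lexx orbT.
clearbody d.
have d20' : 0 < d / 2 by rewrite divr_gt0.
have [d3 d30 d3P] := (within_itv_cvgP _ _ _).1 z_cont p p_in _ d20'.
have [d4 d40 d4P] : exists2 d4, 0 < d4 & forall t, t \in `[p, q] -> `|t - p| < d4 ->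
    `|u t - u p| < d.
  (* Breaks are interior, so [u] is continuous at [p] from within [[p, q]]. *)
  have [s ss sP] := u_pc; have := sP p p_in.
  rewrite ifF; last by apply/negbTE/negP => /ss; rewrite in_itv /= ltxx.
  move=> /cvgrPdist_lt /(_ d d0) /nbhs_ballP[d4 /= d40 d4P].
  exists d4 => // t tpq tp; rewrite distrC; apply: d4P => //.
  by rewrite /ball /= distrC.
(* Target size for [y - z]: inside all radii, within [d / 2] so that [y] stays near [x], and small
   enough that the linear term of [rate] is at most [e]. *)
pose m := Num.min (Num.min (Num.min r r1) (Num.min r3 (d / 2))) (e / (N%:R * r2^-1 + 1)).
have D0 : 0 < N%:R * r2^-1 + 1 :> R by rewrite ltr_wpDl // mulr_ge0 // invr_ge0 ltW.
have m0 : 0 < m by rewrite !lt_min r0 r10 r30 d20' divr_gt0.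
have [mr [mr1 [mr3 [md me]]]] : m <= r /\ m <= r1 /\ m <= r3 /\ m <= d / 2 /\
    m <= e / (N%:R * r2^-1 + 1).
  by rewrite /m !ge_min !lexx !orbT.
clearbody m.
(* Bound on the needle length: it ends before [q], moves the state by less than [m], and sees [t],
   [z t] and [u t] still close to their values at [p]. *)
pose k := Num.min (Num.min (q - p) (m / gain)) (Num.min d (Num.min d3 d4)).
have k0 : 0 < k by rewrite !lt_min subr_gt0 pq divr_gt0 // d0 d30 d40.
have [kq [km [kd [kd3 kd4]]]] : k <= q - p /\ k <= m / gain /\ k <= d /\ k <= d3 /\ k <= d4.
  by rewrite /k !ge_min !lexx !orbT.
clearbody k.
pose h := k / 2; have h0 : 0 < h by rewrite divr_gt0.
have hk : h < k by rewrite /h gtr_pMr // invf_lt1 // ltr1n.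
clearbody h.
pose a := p + h.
have ha : a - p = h by rewrite /a addrAC subrr add0r.
have apq : a \in `]p, q[.
  by rewrite in_itv /= /a ltrDl h0 -ltrBrDl (lt_le_trans hk).
have pa : p < a by rewrite /a ltrDl.
have aq : a < q by move: apq; rewrite in_itv /= => /andP[].
have gh : gain * h < m.
  by rewrite mulrC -ltr_pdivlMr //; exact: lt_le_trans km.
have [|y [ys yz]] := perturbed_state apq; first by rewrite ha; exact: lt_le_trans mr.
rewrite ha in yz.
have yr t : t \in `[p, q] -> `|y t - z t| < m.
  by move=> tpq; apply: le_lt_trans (yz t tpq) gh.
have [phi [s [phic phi0 phid phiq]]] := loss_variation apq ys
  (fun t tpq => lt_le_trans (yr t tpq) mr).
have u'_pc := piecewise_continuous_needle w apq u_pc.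
have := u_min u'_pc ys; rewrite -subr_ge0 phiq => loss.
have rem : `|T (y q) - T (z q) - \sum_j (y q - z q) j 0 * 'D_(delta_mx j 0) T (z q)|
    <= e * (gain * h).
  apply: (le_trans (r3P (y q) (lt_le_trans (yr q q_in) mr3))).
  by rewrite ler_pM2l //; exact: yz.
pose dH := H p x w - H p x (u p).
have early : `|phi a - dH * (a - p)| <= 3 * e * (a - p).
  apply: (normr_le_of_derive (s := s) (g := fun t => phi t - dH * (t - p))
    (e := fun t => 3 * e * (t - p))
    (dg := fun t => rate y (needle a w u) t - dH) (de := fun=> 3 * e) (ltW pa)).
  - apply: within_continuousB; last exact: within_continuous_affine.
    by apply: continuous_subspaceW phic; apply: subset_itvl; rewrite bnd_simp ltW.
  - exact: within_continuous_affine.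
  - move=> t; rewrite in_itv /= => /andP[pt ta] ts.
    have tpq : t \in `]p, q[ by rewrite in_itv /= pt (lt_trans ta).
    have tpq' := subset_itv_oo_cc tpq.
    split; last 1 first.
    + have tp : `|t - p| < h by rewrite ger0_norm ?subr_ge0 ?ltW // ltrBlDl.
      have near c : k <= c -> `|t - p| < c.
        by move=> kc; exact: lt_trans tp (lt_le_trans hk kc).
      have zt : `|z t - x| < d / 2 by rewrite -zp; apply: d3P => //; exact: near.
      have yt : `|y t - x| < d.
        rewrite (_ : y t - x = (y t - z t) + (z t - x)); last by rewrite addrA subrK.
        apply: (le_lt_trans (ler_normD _ _)); rewrite [d]splitr ltrD //.
        exact: lt_le_trans (yr t tpq') md.
      have c1 : `|H t (y t) w - H p x w| < e.
        by apply: d1P; rewrite ?subrr ?normr0 ?near ?(lt_le_trans yt) // (le_trans kd).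
      have c2 : `|H t (z t) (u t) - H p x (u p)| < e.
        apply: d2P => //; [exact: near (le_trans kd dd2)| |].
          apply: lt_le_trans zt _; apply: le_trans dd2.
          by rewrite ler_pdivrMr // ler_peMr ?ler1n // ltW.
        by apply: lt_le_trans dd2; apply: d4P => //; exact: near.
      have c3 : `|\sum_j (y t - z t) j 0 * dstate H j t (z t) (u t)| <= e.
        apply: (@le_trans _ _ (\sum_(j < N) m * r2^-1)).
          apply: (le_trans (ler_norm_sum _ _ _)); apply: ler_sum => j _.
          rewrite normrM ler_pM //.
            by apply: (le_trans (ler_entry_norm _ _)); rewrite ltW // yr.
          by apply: r2P => //; rewrite subrr normr0.
        rewrite sumr_const card_ord -mulr_natl mulrCA.
        apply: (@le_trans _ _ (m * (N%:R * r2^-1 + 1))).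
          by apply: ler_wpM2l; [exact: ltW|rewrite lerDl].
        by rewrite -ler_pdivlMr.
      rewrite /rate /needle ta -/H.
      set S := \sum_j _ in c3 *.
      rewrite (_ : _ - dH = (H t (y t) w - H p x w) -
        (H t (z t) (u t) - H p x (u p)) - S); last by rewrite /dH; ring.
      rewrite (_ : 3 * e = e + e + e); last by ring.
      apply: (le_trans (ler_normB _ _)); rewrite lerD //.
      by apply: (le_trans (ler_normB _ _)); rewrite lerD // ltW.
    + by apply: is_deriveB; [exact: phid|exact: is_derive_affine].
    + exact: is_derive_affine.
  - by rewrite phi0 !subrr !mulr0 subrr normr0.
have late : `|phi q - phi a| <= N%:R * e * (gain * h) * (q - a).
  apply: (normr_le_of_derive (s := s) (g := fun t => phi t - phi a)
    (e := fun t => N%:R * e * (gain * h) * (t - a))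
    (dg := fun t => rate y (needle a w u) t - 0) (de := fun=> N%:R * e * (gain * h))
    (ltW aq)).
  - apply: within_continuousB; last by move=> t; exact: cvg_cst.
    by apply: continuous_subspaceW phic; apply: subset_itvr; rewrite bnd_simp ltW.
  - exact: within_continuous_affine.
  - move=> t; rewrite in_itv /= => /andP[at_ tq] ts.
    have tpq : t \in `]p, q[ by rewrite in_itv /= (lt_trans pa).
    have tpq' := subset_itv_oo_cc tpq.
    split; last 1 first.
    (* With equal controls [rate] is the Taylor remainder of [H] in the state, at most [N%:R * e]
       times the distance of the states. *)
    + rewrite subr0 /rate /needle ltNge (ltW at_) /= -/H.
      have := @first_order_le R N (fun b => H t b (u t)) (y t) (z t)
        (fun j => dstate H j t (z t) (u t)) e (fun b => hd t b (u t) tpq').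
      move=> fo; apply: (le_trans (fo _)).
        move=> c j /andP[c0 c1]; apply/ltW; apply: (r1P j t _ tpq').
        rewrite addrAC subrr add0r normrZ ger0_norm //.
        apply: (@le_lt_trans _ _ `|y t - z t|); first by rewrite ler_piMl.
        exact: lt_le_trans (yr t tpq') mr1.
      by rewrite ler_wpM2l ?yz // mulr_ge0 // ltW.
    + by apply: is_deriveB; exact: phid.
    + exact: is_derive_affine.
  - by rewrite !subrr normr0 mulr0.
rewrite ha in early.
have lq : N%:R * e * (gain * h) * (q - a) <= N%:R * e * (gain * h) * (q - p).
  apply: ler_wpM2l; last by rewrite lerD2l lerN2 ltW.
  by apply: mulr_ge0; apply: mulr_ge0 => //; exact: ltW.
rewrite -(ler_pM2r h0).
rewrite (_ : e * _ * h = 3 * e * h + N%:R * e * (gain * h) * (q - p) +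
  e * (gain * h)); last by ring.
rewrite (_ : (_ - _) * h = - (dH * h)); last by rewrite /dH; ring.
move: early late rem; rewrite !ler_norml.
move=> /andP[_ E] /andP[_ F] /andP[_ G].
lra.
Qed.

End fixed_radius.

(** The radius, hence [C], is fixed before [e]; the estimate applied to [e / C] leaves an arbitrary
    error [e]. *)
Lemma hamiltonian_min : hamiltonian p x (u p) <= hamiltonian p x w.
Proof.
have [r r0 rP] := exists_tube_radius.
set C := 3 + N%:R * gain r * (q - p) + gain r.
have g0 := gain_gt0 r0.
have C0 : 0 < C.
  have : 0 <= N%:R * gain r * (q - p).
    by rewrite mulr_ge0 ?subr_ge0 // mulr_ge0 // ltW.
  by rewrite /C; lra.
apply/ler_addgt0Pr => e e0; rewrite -lerBlDl.
have := variation_estimate r0 rP (divr_gt0 e0 C0).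
by rewrite divfK ?gt_eqF.
Qed.

End needle_variation.

(** For [p = q] the control does not influence the loss and minimality says nothing about it, hence
    the strict inequality. Since [w] ranges over the whole control space, the minimum of the
    Hamiltonian is a stationary point. *)
Theorem theorem3 (R : realType) (N M : nat) (N_ge1 : (1 <= N)%N)
    (M_ge1 : (1 <= M)%N) (q : R)
    (f : R -> 'cV[R]_N -> 'cV[R]_M -> 'cV[R]_N)
    (Rloss : R -> 'cV[R]_N -> 'cV[R]_M -> R)
    (Tloss : 'cV[R]_N -> R)
    (theta : R -> 'cV[R]_N -> R -> 'cV[R]_M)
    (z lambda : R -> 'cV[R]_N -> R -> 'cV[R]_N)
    (theta_adm : forall (p : R) (x : 'cV[R]_N), p <= q -> piecewise_continuous p q (theta p x))
    (f_C1 : forall p : R, p <= q -> C1_in_state p q f)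
    (f_diff : forall p : R, p <= q -> differentiable_in_control p q f)
    (z_state : forall (p : R) (x : 'cV[R]_N), p <= q -> state p q f x (theta p x) (z p x))
    (Tloss_diff : forall y : 'cV[R]_N, differentiable Tloss y)
    (Rloss_C1 : forall p : R, p <= q -> C1_in_state (W := R) p q Rloss)
    (Rloss_diff : forall p : R, p <= q ->
       differentiable_in_control (W := R) p q Rloss)
    (Rloss_L2 : forall p : R, p <= q -> square_integrable p q Rloss)
    (lambda_adj : forall (p : R) (x : 'cV[R]_N), p <= q ->
       adjoint_state p q f Rloss Tloss (theta p x) (z p x) (lambda p x)) :
  let Lambda := fun p x => lambda p x p in
  let Psi := fun p x => theta p x p in
  forall (p : R) (x : 'cV[R]_N), p < q ->
    minimises p q f Rloss Tloss x (theta p x) (z p x) ->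
    grad (Rloss p x) (Psi p x)
      + (Jac (f p x) (Psi p x))^T *m Lambda p x = 0.
Proof.
move=> Lambda Psi p x pq umin; have pq' := ltW pq.
pose H := hamiltonian f Rloss (lambda p x) p x.
have Hmin v : H (Psi p x) <= H v.
  apply: (hamiltonian_min (z := z p x) v pq _ _ (Tloss_diff _)
    (theta_adm p x pq') (z_state p x pq') (lambda_adj p x pq') umin).
  - by move=> i; exact/C1_in_state_smooth/C1_in_state_entry/f_C1.
  - exact/C1_in_state_smooth/Rloss_C1.
have p_in : p \in `[p, q] by rewrite in_itv /= lexx.
have fd i v : differentiable (fun v => f p x v i 0) v.
  apply: (@differentiable_comp _ _ _ _ (f p x) (fun m : 'cV[R]_N => m i 0)).
    exact: f_diff pq' _ _ _ p_in.
  exact: differentiable_coord.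
have Ld v : differentiable (Rloss p x) v by exact: Rloss_diff pq' _ _ _ p_in.
have HE : H = (\sum_i (lambda p x p i 0 *: (fun v => f p x v i 0))) + Rloss p x.
  by apply/funext => v; rewrite fctE fct_sumE.
have fsd v : differentiable (\sum_i (lambda p x p i 0 *: (fun v => f p x v i 0))) v.
  by apply: differentiable_sum => i; exact: differentiableZ.
have Hd v : differentiable H v by rewrite HE; exact: differentiableD.
apply/matrixP => j k; rewrite ord1 {k} !mxE.
set e := delta_mx j 0.
have HE' : 'D_e H (Psi p x) =
    \sum_i lambda p x p i 0 * 'D_e (fun v => f p x v i 0) (Psi p x)
    + 'D_e (Rloss p x) (Psi p x).
  have fder i : derivable (fun v => f p x v i 0) (Psi p x) e.
    exact/diff_derivable/fd.
  rewrite HE deriveD; [|exact/diff_derivable/fsd|exact/diff_derivable/Ld].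
  congr (_ + _); rewrite derive_sum; last by move=> i; exact: derivableZ.
  by apply: eq_bigr => i _; rewrite deriveZ.
have along (s : R) := @is_derive_along R M H (Psi p x) e s (diff_derivable (Hd _)).
(* Fermat's rule along each coordinate line; the interval from -1 to 1 only makes 0 an interior
   point. *)
have [||||_ D0] := @derive1_at_min R (fun s => H (Psi p x + s *: e)) (-1) 1 0.
- exact: le_trans (lerN10 R) ler01.
- by move=> s _; case: (along s).
- by rewrite in_itv /= ltrN10 ltr01.
- by move=> s _; rewrite scale0r addr0; exact: Hmin.
have := @derive_val _ _ _ _ _ _ _ (along 0).
rewrite D0 scale0r addr0 HE' => H0; rewrite [RHS]H0 addrC; congr (_ + _).
by apply: eq_bigr => i _; rewrite !mxE mulrC.
Qed.
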